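(* Let $w,h\ge 3$ be odd integers. If $L$ is a hitomezashi loop with width $w$ and height $h$, then $$\operatorname{area}(L)\ \ge\ 2(w+h)-7.$$ Moreover, equality is achieved if and only if either $L$ is a cross or $\min\{w,h\}=3$.
   Context: A stitch is a unit-length axis-parallel line segment in $\mathbb R^2$ whose endpoints are in $\mathbb Z^2$. A hitomezashi pattern is a collection of stitches such that every point of $\mathbb Z^2$ is an endpoint of exactly one horizontal stitch and exactly one vertical stitch of the collection. A hitomezashi loop is a bounded connected component of the union of the stitches of a hitomezashi pattern (it is a closed polygon). The longitude (respectively, latitude) of a stitch is the $x$-coordinate (respectively, $y$-coordinate) of its midpoint. The width (respectively, height) of a hitomezashi loop $L$ is the maximum difference between the longitudes (respectively, latitudes) of the stitches in $L$. $\operatorname{area}(L)$ is the area of the region enclosed by $L$. Grid labels: a hitomezashi pattern is encoded by labels $\varepsilon_i,\eta_j\in\mathbb Z/2\mathbb Z$ ($i,j\in\mathbb Z$). The stitches on the horizontal line $y=i$ are the segments from $(k,i)$ to $(k+1,i)$ with $k\equiv\varepsilon_i \pmod 2$, and the stitches on the vertical line $x=j$ are the segments from $(j,k)$ to $(j,k+1)$ with $k\equiv\eta_j\pmod 2$. Crosses: suppose $w,h\ge 5$ are odd, and let $3\le\alpha\le w-2$ and $3\le\beta\le h-2$ be odd integers. In the rectangular region $[0,w]\times[0,h]$ put $\varepsilon_0=\varepsilon_h=\varepsilon_{\beta-1}=\varepsilon_\beta=\eta_0=\eta_w=\eta_{\alpha-1}=\eta_\alpha=0$ and set all other grid labels ($\varepsilon_i$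 with $0\le i\le h$ and $\eta_j$ with $0\le j\le w$) equal to $1$. The resulting pattern in this region has exactly one loop of width $w$ and height $h$; the cross $\operatorname{Cross}^{\alpha,\beta}_{w\times h}$ is this loop, considered modulo translation. ''$L$ is a cross'' means that $L$ is a translate of some $\operatorname{Cross}^{\alpha,\beta}_{w\times h}$. *)

(* Defs.v *)
From HB Require Import structures.
From mathcomp Require Import all_boot all_order all_algebra.
From mathcomp Require Import all_classical all_reals all_analysis.

Set Implicit Arguments.
Unset Strict Implicit.
Unset Printing Implicit Defensive.

Import Order.TTheory GRing.Theory Num.Theory.
Import numFieldNormedType.Exports.

Local Open Scope classical_set_scope.
Local Open Scope ring_scope.

(* [HStitch k i] goes from (k, i) to (k + 1, i);
   [VStitch j k] goes from (j, k) to (j, k + 1). *)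
Inductive stitch : Type :=
  | HStitch of int & int
  | VStitch of int & int.

Definition horizontal (s : stitch) : bool :=
  if s is HStitch _ _ then true else false.

Definition endpoint (s : stitch) (v : int * int) : Prop :=
  match s with
  | HStitch k i => v = (k, i) \/ v = (k + 1, i)
  | VStitch j k => v = (j, k) \/ v = (j, k + 1)
  end.

Definition hitomezashi (P : set stitch) : Prop :=
  forall v : int * int,
    (exists! s, P s /\ horizontal s /\ endpoint s v) /\
    (exists! s, P s /\ ~~ horizontal s /\ endpoint s v).

Definition label_pattern (eps eta : int -> 'Z_2) : set stitch :=
  [set s | match s with
           | HStitch k i => k%:~R = eps i
           | VStitch j k => k%:~R = eta j
           end].

Section Plane.
Variable R : realType.

Definition segment (s : stitch) : set (R * R) :=
  match s with
  | HStitch k i => [set p | k%:~R <= p.1 <= (k + 1)%:~R /\ p.2 = i%:~R]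
  | VStitch j k => [set p | p.1 = j%:~R /\ k%:~R <= p.2 <= (k + 1)%:~R]
  end.

Definition midpoint (s : stitch) : R * R :=
  match s with
  | HStitch k i => (k%:~R + 2^-1, i%:~R)
  | VStitch j k => (j%:~R, k%:~R + 2^-1)
  end.

Definition longitude (s : stitch) : R := (midpoint s).1.

Definition latitude (s : stitch) : R := (midpoint s).2.

Definition stitch_union (P : set stitch) : set (R * R) :=
  \bigcup_(s in P) segment s.

Definition loop_of (P : set stitch) (L : set (R * R)) : Prop :=
  exists p, [/\ stitch_union P p,
                L = connected_component (stitch_union P) p &
                bounded_set L].

Definition hitomezashi_loop (L : set (R * R)) : Prop :=
  exists P, hitomezashi P /\ loop_of P L.

Definition stitches_in (L : set (R * R)) : set stitch :=
  [set s | segment s `<=` L].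

Definition is_max (A : set R) (m : R) : Prop := A m /\ ubound A m.

Definition has_width (L : set (R * R)) (w : R) : Prop :=
  is_max [set longitude s - longitude t | s in stitches_in L & t in stitches_in L] w.

Definition has_height (L : set (R * R)) (h : R) : Prop :=
  is_max [set latitude s - latitude t | s in stitches_in L & t in stitches_in L] h.

(* The union of the bounded components of the complement of L. *)
Definition enclosed (L : set (R * R)) : set (R * R) :=
  [set p | ~ L p /\ bounded_set (connected_component (~` L) p)].

Definition area (L : set (R * R)) : \bar R :=
  (lebesgue_measure \x lebesgue_measure)%E (enclosed L).

Definition rectangle (w h : nat) : set (R * R) :=
  [set p | 0 <= p.1 <= w%:R /\ 0 <= p.2 <= h%:R].

(* Labels of lines that miss the rectangle are left unconstrained: they do not
   affect the loops contained in it. *)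
Definition cross_labels (w h alpha beta : nat) (eps eta : int -> 'Z_2) : Prop :=
  (forall i : nat, (i <= h)%N ->
     eps i = if i \in [:: 0; beta.-1; beta; h]%N then 0 else 1) /\
  (forall j : nat, (j <= w)%N ->
     eta j = if j \in [:: 0; alpha.-1; alpha; w]%N then 0 else 1).

Definition cross_loop (w h alpha beta : nat) (C : set (R * R)) : Prop :=
  exists eps eta, cross_labels w h alpha beta eps eta /\
    [/\ loop_of (label_pattern eps eta) C, C `<=` rectangle w h,
        has_width C w%:R & has_height C h%:R].

Definition cross_params (w h alpha beta : nat) : Prop :=
  [/\ odd w, odd h, (5 <= w)%N & (5 <= h)%N] /\
  [/\ odd alpha, odd beta, (3 <= alpha <= w - 2)%N & (3 <= beta <= h - 2)%N].

Definition is_cross (L : set (R * R)) : Prop :=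
  exists w h alpha beta C (v : R * R),
    [/\ cross_params w h alpha beta, cross_loop w h alpha beta C &
        L = [set p + v | p in C]].

End Plane.

(* Main.v *)
Require Import Defs.
From mathcomp Require Import all_boot all_order all_algebra.
From mathcomp Require Import all_classical all_reals all_analysis.
From mathcomp Require Import zify lra.

Set Implicit Arguments.
Unset Strict Implicit.
Unset Printing Implicit Defensive.

Import Order.TTheory GRing.Theory Num.Theory.
Import numFieldNormedType.Exports.

Local Open Scope classical_set_scope.
Local Open Scope ring_scope.

(** Cut the plane into unit cells and let S be the set of the cells that [L]
    encloses.  The area of [L] is the number of cells of S ([area_loop]), so the
    theorem is a statement about S.

    At each of its vertices [L] has one horizontal and one vertical stitch, so it
    turns there, and the cells on the enclosed side of its stitches all have
    the same chessboard colour ([inner_side]).  Call the cells of this colour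
    inner and the others outer.  An outer cell of S has its four neighbours
    in S.  As the stitches of the pattern alternate on each line, all of those on
    a given line have their inner cell on the same side.  If this is the right
    side, a cell of S on the left of the line that is inner is never cut off from
    its right neighbour, and if it is the left side, the same holds the other
    way round.

    Let b(x) be the number of outer cells of S in column x, and r(x) the number of
    vertical runs of S there.  A run starts and ends with inner cells, so the
    column has 2 b(x) + r(x) cells, and b(x+1) = b(x) + r(x) or
    b(x) = b(x+1) + r(x+1), according to the type of the line in between.  In
    particular consecutive values of b differ, and b vanishes at both ends.  An
    interior column with b(x) = 0 is a bottleneck.  Let z be the number
    of bottleneck columns and z' that of bottleneck rows.

    A bottleneck row forces a gap in the two columns next to each of its cells.
    Choose one cell in each bottleneck row and let k(x) be the number of chosen
    cells in column x.  Then r(x) >= 1 + k(x-1) + k(x+1), and b - k is still a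
    profile whose consecutive values differ and which vanishes where b does.
    Two consecutive values of b - k have sum at least 3, or at least 1 if one of
    them is 0.  Summation over the columns yields
    |S| >= 4w - 7 - 4z + 4z' ([cell_count_lower]).  The average of this and of
    the same bound with rows and columns exchanged is |S| >= 2(w + h) - 7.

    In the case of equality all these estimates are sharp.  Then b - k is 1 at the
    odd columns and 0 or 2 at the even ones, every gap comes from a chosen
    cell, and, if w and h are at least 5, the odd columns have a single outer
    cell each, all of them in the same row Y.  Likewise the odd rows have a
    single outer cell each, all in the same column X.  It follows that X and Y
    are even, that X is the only even column where b - k is 2, and that
    the lines have the types of a cross ([extremal_cross]).  Conversely these
    types determine S ([cross_shapeE]), and its cells can be counted; for
    width 3 the rows alternately have 3 cells and 1 cell ([cell_count_thin]).

    The topology that identifies the enclosed set is elementary here.  The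
    parity of the number of stitches on the left of a cell changes exactly across
    [L], so the cells of odd parity form a bounded set that is open and closed
    in the complement of [L].  A cell of even parity is connected to infinity: the
    set of cells reached from it borders either every stitch of [L] or none,
    because its boundary can be followed through the vertices
    ([escapes_all]). *)

(** * Coloured regions and their columns *)

(** The colour of a cell of the chessboard; [a] says which of the two colours
    is the inner one. *)
Definition inner (a : bool) (x y : nat) : bool := odd (x + y) == a.

(** What is kept of a loop: the set [S] of the enclosed cells of its bounding
    box, the colour [a] of the cells that lie on the enclosed side of the
    stitches of the loop, and the types [u], [t] of the vertical and horizontal
    lines.  Line [x.+1] runs between the columns [x] and [x.+1], and [u x.+1]
    says that the pattern has its stitches on this line at the rows where the
    right cell is inner; such a line is called open from the left, since it cuts
    no inner cell on its left off from its right neighbour, and the other lines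
    are open from the right.  Hence two cells with [u x.+1 = inner a x y] are not
    separated by a stitch, and one of two cells that are separated by the loop
    is in [S], namely the inner one.  There is no column before column 0, so its
    left boundary is treated by [cfg_left]. *)
Record config (w h : nat) (a : bool) (u t : nat -> bool)
    (S : nat -> nat -> bool) : Prop := Config {
  cfg_box : forall x y, S x y -> (x < w)%N && (y < h)%N;
  cfg_col : forall x, (x < w)%N -> exists y, S x y;
  cfg_row : forall y, (y < h)%N -> exists x, S x y;
  cfg_left : forall y, S 0%N y -> inner a 0 y;
  cfg_bottom : forall x, S x 0%N -> inner a x 0;
  cfg_hopen : forall x y, u x.+1 = inner a x y -> S x y = S x.+1 y;
  cfg_hside : forall x y, S x y != S x.+1 y -> S x y = inner a x y;
  cfg_vopen : forall x y, t y.+1 = inner a x y -> S x y = S x y.+1;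
  cfg_vside : forall x y, S x y != S x y.+1 -> S x y = inner a x y
}.

Definition transpose (S : nat -> nat -> bool) := fun x y => S y x.

Lemma innerC a x y : inner a x y = inner a y x.
Proof. by rewrite /inner addnC. Qed.

Lemma innerSl a x y : inner a x.+1 y = ~~ inner a x y.
Proof. by rewrite /inner addSn /=; case: (odd _); case: a. Qed.

Lemma innerSr a x y : inner a x y.+1 = ~~ inner a x y.
Proof. by rewrite innerC innerSl innerC. Qed.

(** Everything is symmetric in the two directions: facts about columns
    become facts about rows through this lemma. *)
Lemma config_transpose w h a u t S :
  config w h a u t S -> config h w a t u (transpose S).
Proof.
case=> *; split; rewrite /transpose; eauto.
- by move=> x y; rewrite andbC; auto.
- by move=> y; rewrite innerC; auto.
- by move=> y; rewrite innerC; auto.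
- by move=> x y; rewrite innerC; auto.
- by move=> x y; rewrite innerC; auto.
- by move=> x y; rewrite innerC; auto.
- by move=> x y; rewrite innerC; auto.
Qed.

Definition cell_count (w h : nat) (S : nat -> nat -> bool) : nat :=
  \sum_(0 <= x < w) \sum_(0 <= y < h) S x y.

Lemma cell_count_transpose w h S :
  cell_count h w (transpose S) = cell_count w h S.
Proof. by rewrite /cell_count exchange_big_nat. Qed.

Lemma sum_nat_gt0 m n (P : nat -> bool) i :
  (m <= i < n)%N -> P i -> (0 < \sum_(m <= j < n) P j)%N.
Proof.
move=> /andP[mi ni] Pi; rewrite (big_cat_nat mi (ltnW ni)) /=.
by rewrite (big_ltn ni) Pi addnA addn1.
Qed.

Lemma sum_nat_eq1 n (P : nat -> bool) i :
  (i < n)%N -> P i -> (forall j, (j < n)%N -> P j -> j = i) ->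
  (\sum_(0 <= j < n) P j = 1)%N.
Proof.
move=> ni Pi Pu; rewrite (big_cat_nat (leq0n i) (ltnW ni)) /= (big_ltn ni) Pi.
rewrite big_nat big1 ?add0n; last first.
  move=> j ji; case Pj: (P j) => //.
  by have := Pu j (ltn_trans ji ni) Pj; move: ji => /[swap] ->; rewrite ltnn.
rewrite big_nat big1 ?addn0 // => j /andP[ij jn]; case Pj: (P j) => //.
by move: ij; rewrite (Pu j jn Pj) ltnn.
Qed.

Lemma sum_nat_pred1 n i : (\sum_(0 <= j < n) (i == j) = (i < n))%N.
Proof.
case: ltnP => ni; first by apply: (sum_nat_eq1 ni) => // j _ /eqP ->.
rewrite big_nat big1 // => j jn; case: eqP => // ij; lia.
Qed.

(** This is how equality in a global estimate is turned into equality in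
    each of the local estimates it is the sum of. *)
Lemma sum_nat_eq_pointwise n (f g : nat -> nat) :
  (forall i, (i < n)%N -> (f i <= g i)%N) ->
  (\sum_(0 <= i < n) g i <= \sum_(0 <= i < n) f i)%N ->
  forall i, (i < n)%N -> f i = g i.
Proof.
elim: n => // n IH fg; rewrite !big_nat_recr //= => le_s.
have le_n : (\sum_(0 <= i < n) f i <= \sum_(0 <= i < n) g i)%N.
  by rewrite !big_mkord leq_sum // => i _; apply: fg; rewrite ltnW // ltnS.
have fgn := fg n (ltnSn n).
move=> i; rewrite ltnS leq_eqVlt => /predU1P[->|ni]; first by lia.
by apply: IH => // [j jn|]; [apply: fg; rewrite ltnW | lia].
Qed.

Definition col_inner (h : nat) (a : bool) (S : nat -> nat -> bool) (x : nat) : nat :=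
  \sum_(0 <= y < h) (S x y && inner a x y).

Definition col_outer (h : nat) (a : bool) (S : nat -> nat -> bool) (x : nat) : nat :=
  \sum_(0 <= y < h) (S x y && ~~ inner a x y).

(** The number of vertical runs of the column, counted by their highest
    cells. *)
Definition col_tops (h : nat) (S : nat -> nat -> bool) (x : nat) : nat :=
  \sum_(0 <= y < h) (S x y && ~~ S x y.+1).

(** Only gaps of a single cell are counted, each of them at the cell below. *)
Definition gaps (h : nat) (S : nat -> nat -> bool) (x : nat) : nat :=
  \sum_(0 <= y < h) (S x y && ~~ S x y.+1 && S x y.+2).

Definition bottleneck (w h : nat) (a : bool) (S : nat -> nat -> bool) (x : nat) : bool :=
  (0 < x < w.-1)%N && (col_outer h a S x == 0)%N.

Definition bottlenecks (w h : nat) (a : bool) (S : nat -> nat -> bool) : nat :=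
  \sum_(0 <= x < w) bottleneck w h a S x.

Section Columns.
Variables (w h : nat) (a : bool) (u t : nat -> bool) (S : nat -> nat -> bool).
Hypothesis cfg : config w h a u t S.
Local Open Scope nat_scope.

Local Notation alpha := (col_inner h a S).
Local Notation beta := (col_outer h a S).
Local Notation tops := (col_tops h S).
Local Notation gaps := (gaps h S).

(** An outer cell of [S] has its four neighbours in [S]: a stitch of the loop
    next to it would have the enclosed side at an outer cell. *)
Lemma outer_right x y : S x y -> ~~ inner a x y -> S x.+1 y.
Proof.
move=> Sxy nA; apply/negPn/negP => nS.
by have := cfg_hside cfg (x := x) (y := y); rewrite Sxy nS => /(_ isT) A; rewrite -A in nA.
Qed.

Lemma outer_left x y : S x.+1 y -> ~~ inner a x.+1 y -> S x y.
Proof.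
move=> Sxy; rewrite innerSl negbK => A; apply/negPn/negP => nS.
by have := cfg_hside cfg (x := x) (y := y); rewrite Sxy (negbTE nS) A => /(_ isT).
Qed.

Lemma outer_up x y : S x y -> ~~ inner a x y -> S x y.+1.
Proof.
move=> Sxy nA; apply/negPn/negP => nS.
by have := cfg_vside cfg (x := x) (y := y); rewrite Sxy nS => /(_ isT) A; rewrite -A in nA.
Qed.

Lemma outer_down x y : S x y.+1 -> ~~ inner a x y.+1 -> S x y.
Proof.
move=> Sxy; rewrite innerSr negbK => A; apply/negPn/negP => nS.
by have := cfg_vside cfg (x := x) (y := y); rewrite Sxy (negbTE nS) A => /(_ isT).
Qed.

Lemma outer_col_gt0 x y : S x y -> ~~ inner a x y -> 0 < x < w.-1.
Proof.
case: x => [|x] Sxy nA; first by rewrite (cfg_left cfg Sxy) in nA.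
by have /(cfg_box cfg)/andP[] := outer_right Sxy nA; lia.
Qed.

Lemma outer_row_gt0 x y : S x y -> ~~ inner a x y -> 0 < y < h.-1.
Proof.
case: y => [|y] Sxy nA; first by rewrite (cfg_bottom cfg Sxy) in nA.
by have /(cfg_box cfg)/andP[] := outer_up Sxy nA; lia.
Qed.

Lemma col_outer_eq0P x : reflect (forall y, S x y -> inner a x y) (beta x == 0).
Proof.
apply: (iffP idP) => [b0 y Sxy|H].
  apply/negPn/negP => nA; have /andP[_ yh] := cfg_box cfg Sxy.
  by have := @sum_nat_gt0 0 h (fun y => S x y && ~~ inner a x y) y;
    rewrite yh Sxy nA -/(beta x) (eqP b0) => /(_ isT isT).
apply/eqP; rewrite /col_outer big1_seq // => y _.
by case Sxy: (S x y) => //=; rewrite (H _ Sxy).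
Qed.

Lemma col_outer_first : beta 0 = 0.
Proof. by apply/eqP/col_outer_eq0P => y /(cfg_left cfg). Qed.

Lemma col_outer_last : beta w.-1 = 0.
Proof.
apply/eqP/col_outer_eq0P => y Sxy; apply/negPn/negP => nA.
by have := outer_col_gt0 Sxy nA; lia.
Qed.

(** A column of [S] is a union of vertical runs.  Both ends of a run are
    inner cells, since an outer cell has its neighbours in [S]; so each run has
    one more inner cell than outer cells. *)
Lemma col_innerE x : alpha x = beta x + tops x.
Proof.
have -> : beta x = \sum_(0 <= y < h) (S x y.+1 && ~~ inner a x y.+1).
  have : \sum_(0 <= y < h.+1) (S x y && ~~ inner a x y) = beta x.
    rewrite big_nat_recr //=; case Sxh: (S x h); last by rewrite addn0.
    by have /(cfg_box cfg) := Sxh; rewrite ltnn andbF.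
  rewrite big_nat_recl //; case Sx0: (S x 0) => //=.
  by rewrite (cfg_bottom cfg Sx0) add0n => <-.
rewrite -big_split; apply: eq_bigr => y _ /=; rewrite innerSr negbK.
case A: (inner a x y); rewrite ?andbT ?andbF /=; last first.
  by rewrite add0n; case Sxy: (S x y) => //=; rewrite (outer_up Sxy) ?A.
case Sxy: (S x y) => /=; first by case: (S _ _).
by case Sxy1: (S x y.+1) => //; rewrite (@outer_down x y) // innerSr A in Sxy.
Qed.

(** If the line between two columns is open from the left, then each inner
    cell of [S] on its left faces an outer cell of [S], and conversely; hence
    the number of outer cells grows from left to right by the number of runs.
    [col_inner_open_left] is the mirror image. *)
Lemma col_inner_open_right x : u x.+1 -> alpha x = beta x.+1.
Proof.
move=> ux; apply: eq_bigr => y _; rewrite innerSl negbK.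
case A: (inner a x y); rewrite ?andbF ?andbT //.
by rewrite (cfg_hopen cfg) // ux A.
Qed.

Lemma col_inner_open_left x : ~~ u x.+1 -> alpha x.+1 = beta x.
Proof.
move=> ux; apply: eq_bigr => y _; rewrite innerSl.
case A: (inner a x y); rewrite ?andbF ?andbT //.
by rewrite -(cfg_hopen cfg) // (negbTE ux) A.
Qed.

Lemma col_inner_gt0 x : x < w -> 0 < alpha x.
Proof.
case/(cfg_col cfg) => y Sxy; have /andP[xw yh] := cfg_box cfg Sxy.
case A: (inner a x y).
  by apply: (sum_nat_gt0 (i := y)); rewrite ?Sxy ?A.
have Sxy1 := outer_up Sxy (negbT A).
apply: (sum_nat_gt0 (i := y.+1)); last by rewrite innerSr A Sxy1.
by case/andP: (cfg_box cfg Sxy1).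
Qed.

Lemma col_countE x : \sum_(0 <= y < h) S x y = 2 * beta x + tops x.
Proof.
rewrite mul2n -addnn -addnA -col_innerE /col_inner -big_split /=.
by apply: eq_bigr => y _; case: (S x y); case: inner.
Qed.

Lemma cell_countE : cell_count w h S = 2 * \sum_(0 <= x < w) beta x + \sum_(0 <= x < w) tops x.
Proof.
by rewrite /cell_count big_distrr -big_split /=; apply: eq_bigr => x _; rewrite col_countE.
Qed.

(** A bottleneck column is a valley of the profile of outer cells: if the line
    on its left were open from the left, the inner cells of the previous column
    would face outer cells of this one. *)
Lemma valley x : x < w -> beta x = 0 -> 0 < x < w.-1 -> ~~ u x /\ u x.+1.
Proof.
case: x => // x xw b0 /andP[_ x1w]; split.
  apply/negP => /col_inner_open_right; rewrite b0 => a0.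
  by have := @col_inner_gt0 x; rewrite a0; lia.
apply/negPn/negP => /col_inner_open_left; rewrite b0 => a0.
by have := @col_inner_gt0 x.+2; rewrite a0; lia.
Qed.

Lemma gaps_lt_tops x : x < w -> gaps x < tops x.
Proof.
case/(cfg_col cfg) => y0 Sxy0; have /andP[_ y0h] := cfg_box cfg Sxy0.
have exS : exists y, S x y by exists y0.
have ubS y : S x y -> y <= h by case/(cfg_box cfg)/andP => _ /ltnW.
(* The highest cell of the column ends a run and has no gap above it. *)
case: (ex_maxnP exS ubS) => m Sxm mmax.
have top1 : ~~ S x m.+1 by apply/negP => /mmax; rewrite ltnn.
have mh : m < h by case/andP: (cfg_box cfg Sxm).
suff -> : tops x = gaps x + \sum_(0 <= y < h) (S x y && ~~ S x y.+1 && ~~ S x y.+2).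
  rewrite -[X in X < _]addn0 ltn_add2l; apply: (sum_nat_gt0 (i := m)) => //.
  by rewrite Sxm top1 /=; apply/negP => /mmax; lia.
rewrite -big_split; apply: eq_bigr => y _ /=.
by case: (S x y); case: (S x y.+1); case: (S x y.+2).
Qed.

End Columns.

(** * The lower bound *)

(** A bottleneck row may have several cells; its leftmost one is singled out. *)
Definition spine (w : nat) (S : nat -> nat -> bool) (y : nat) : nat :=
  find (fun x => S x y) (iota 0 w).

Definition spines_at (w h : nat) (a : bool) (S : nat -> nat -> bool) (x : nat) : nat :=
  \sum_(0 <= y < h) (bottleneck h w a (transpose S) y && (spine w S y == x)).

(** This is the number of spines in column [x.-1], except that it vanishes at
    [x = 0]; with [x.-1] column 0 would count its own spines. *)
Definition spines_left (w h : nat) (a : bool) (S : nat -> nat -> bool) (x : nat) : nat :=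
  \sum_(0 <= y < h) (bottleneck h w a (transpose S) y && ((spine w S y).+1 == x)).

(** The number of outer cells, less the number of spines.  A spine in column
    [x] adds one gap to each adjacent column, hence one run there and one
    more outer cell in column [x] itself; the subtraction takes this surplus out
    and leaves a profile that still never stays constant. *)
Definition reduced (w h : nat) (a : bool) (S : nat -> nat -> bool) (x : nat) : nat :=
  (col_outer h a S x - spines_at w h a S x)%N.

Section LowerBound.
Variables (w h : nat) (a : bool) (u t : nat -> bool) (S : nat -> nat -> bool).
Hypothesis cfg : config w h a u t S.
Hypotheses (w_ge3 : (3 <= w)%N) (h_ge3 : (3 <= h)%N).
Local Open Scope nat_scope.

Local Notation beta := (col_outer h a S).
Local Notation tops := (col_tops h S).
Let cfgT := config_transpose cfg.

Local Notation pinched := (bottleneck h w a (transpose S)).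

Lemma spineP y : y < h -> S (spine w S y) y && (spine w S y < w).
Proof.
move=> /(cfg_row cfg)[x Sxy].
have hasx : has (fun x => S x y) (iota 0 w).
  by apply/hasP; exists x => //; rewrite mem_iota; case/andP: (cfg_box cfg Sxy).
have := hasx; rewrite has_find size_iota -/(spine w S y) => lt_w.
by have := nth_find 0 hasx; rewrite -/(spine w S y) nth_iota // add0n => ->.
Qed.

Lemma pinched_inner x y : pinched y -> S x y -> inner a x y.
Proof.
case/andP=> _ /(col_outer_eq0P cfgT) H Sxy.
by rewrite innerC; apply: H.
Qed.

Lemma pinched_vert x y : pinched y -> S x y ->
  S x y.+1 && S x y.-1 && ~~ inner a x y.+1 && ~~ inner a x y.-1.
Proof.
move=> pin Sxy; have A := pinched_inner pin Sxy.
have /andP[yh /eqP b0] := pin.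
have yh' : y < h by lia.
have [nty ty] := valley cfgT yh' b0 yh.
rewrite innerSr A /= andbT.
have -> : S x y.+1 by rewrite -(cfg_vopen cfg) // ty A.
case: y nty yh {yh' ty b0 pin} A Sxy => // y nty _ A Sxy /=.
by rewrite -(innerSr a x y) A andbT (cfg_vopen cfg) // (negbTE nty); move: A; rewrite innerSr => /negbTE.
Qed.

(** The cells above and below a cell of a bottleneck row are outer, so that
    their left and right neighbours are in [S]; the left and right neighbours of
    the cell itself are outer, so that they are not in [S].  A bottleneck row
    therefore makes a gap in the columns on both sides of its spine. *)
Lemma pinched_gap x x' y : pinched y -> S x y -> (x' == x.+1) || (x == x'.+1) ->
  [&& S x' y.-1, ~~ S x' y & S x' y.+1].
Proof.
move=> pin Sxy adj; have A := pinched_inner pin Sxy.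
have nA : ~~ inner a x' y.
  by case/orP: adj A => /eqP ->; rewrite innerSl // negbK.
have -> /= : ~~ S x' y by apply/negP => /(pinched_inner pin); exact/negP.
have /andP[/andP[/andP[S1 S2] A1] A2] := pinched_vert pin Sxy.
case/orP: adj => /eqP E; rewrite E in S1 S2 A1 A2 *; subst.
  by rewrite !(outer_right cfg).
by rewrite !(outer_left cfg (x := x')).
Qed.

Local Notation k := (spines_at w h a S).
Local Notation kl := (spines_left w h a S).

Lemma spines_leftS x : kl x.+1 = k x.
Proof. by []. Qed.

Lemma pinched_lt y : pinched y -> y < h.
Proof. by case/andP => /andP[_]; lia. Qed.

Lemma spine_bounds y : pinched y -> 0 < spine w S y < w.-1.
Proof.
move=> pin; have /andP[Ss _] := spineP (pinched_lt pin).
have /andP[/andP[/andP[S1 _] A1] _] := pinched_vert pin Ss.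
by have := outer_col_gt0 cfg S1 A1.
Qed.

(** The inner cells of a column with a spine are closed on both sides,
    as otherwise the bottleneck row would have an outer cell. *)
Lemma spine_peak x : 0 < k x -> 0 < x < w.-1 /\ u x && ~~ u x.+1.
Proof.
rewrite /spines_at.
have [/hasP[y yh /andP[pin /eqP sx]] _|/hasPn H] := boolP
    (has (fun y => pinched y && (spine w S y == x)) (index_iota 0 h)); last first.
  by rewrite big1_seq // => y /andP[_ /H /negbTE ->].
have /andP[Ss _] := spineP (pinched_lt pin); rewrite sx in Ss.
have A := pinched_inner pin Ss.
have := spine_bounds pin; rewrite sx => xb; split=> //.
have nout x' : ~~ inner a x' y -> S x' y = false.
  by move=> nA; apply/negP => /(pinched_inner pin); apply/negP.
apply/andP; split; last first.
  apply/negP => ux; have := nout x.+1; rewrite innerSl A => /(_ isT).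
  by rewrite -(cfg_hopen cfg) ?Ss // ux A.
case: x xb {sx} Ss A => // x _ Ss A.
have nA : ~~ inner a x y by rewrite -(innerSl a x y).
apply/negPn/negP => ux; have := nout x nA.
by rewrite (cfg_hopen cfg) ?Ss // (negbTE ux) (negbTE nA).
Qed.

(** The gaps are indexed by the row below the gap, the bottleneck rows by
    themselves. *)
Lemma sum_nat_shift n (f : nat -> nat) :
  f 0 = 0 -> f n = 0 -> \sum_(0 <= y < n) f y = \sum_(0 <= y < n) f y.+1.
Proof.
move=> f0 fn; transitivity (\sum_(0 <= y < n.+1) f y).
  by rewrite big_nat_recr //= fn addn0.
by rewrite big_nat_recl // f0 add0n.
Qed.

Lemma spines_le_gap x y :
  (pinched y.+1 && ((spine w S y.+1).+1 == x)) + (pinched y.+1 && (spine w S y.+1 == x.+1))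
    <= S x y && ~~ S x y.+1 && S x y.+2.
Proof.
case pin: (pinched y.+1) => //=.
have /andP[Ss _] := spineP (pinched_lt pin).
have gap := pinched_gap pin Ss.
have [E|nE] := eqVneq (spine w S y.+1).+1 x.
  have -> : (spine w S y.+1 == x.+1) = false by lia.
  by have := gap x; rewrite E eqxx => /(_ isT)/and3P[-> -> ->].
have [E|//] := eqVneq (spine w S y.+1) x.+1.
by have := gap x; rewrite E eqxx orbT => /(_ isT)/and3P[-> -> ->].
Qed.

Lemma spines_gapsE x : kl x + k x.+1 = \sum_(0 <= y < h)
  ((pinched y.+1 && ((spine w S y.+1).+1 == x)) + (pinched y.+1 && (spine w S y.+1 == x.+1))).
Proof.
rewrite -big_split /= sum_nat_shift //.
by have -> : pinched h = false by apply/negP => /pinched_lt; rewrite ltnn.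
Qed.

(** The gaps made by the spines of the two adjacent columns are in
    different rows, and there is one more run than there are gaps. *)
Lemma spines_lt_tops x : x < w -> kl x + k x.+1 < tops x.
Proof.
move=> xw; apply: leq_ltn_trans (gaps_lt_tops cfg xw).
rewrite spines_gapsE /gaps !big_mkord; apply: leq_sum => y _; exact: spines_le_gap.
Qed.

Local Notation z := (bottlenecks w h a S).
Local Notation z' := (bottlenecks h w a (transpose S)).

Lemma sum_spines (f : nat -> nat) : (forall y, pinched y -> f (spine w S y) < w) ->
  \sum_(0 <= x < w) \sum_(0 <= y < h) (pinched y && (f (spine w S y) == x)) = z'.
Proof.
move=> fw; rewrite exchange_big_nat /=; apply: eq_bigr => y _.
case pin: (pinched y) => /=; last by rewrite big1.
by rewrite sum_nat_pred1 fw.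
Qed.

Lemma sum_spines_at : \sum_(0 <= x < w) k x = z'.
Proof. by apply: (sum_spines (f := id)) => y /spine_bounds; lia. Qed.

Lemma sum_spines_left : \sum_(0 <= x < w) kl x = z'.
Proof. by apply: (sum_spines (f := succn)) => y /spine_bounds; lia. Qed.

Lemma spines_at_first : k 0 = 0.
Proof. by apply/eqP; rewrite -leqn0 leqNgt; apply/negP => /spine_peak[]. Qed.

Lemma spines_at_last : k w = 0.
Proof. by apply/eqP; rewrite -leqn0 leqNgt; apply/negP => /spine_peak[]; lia. Qed.

Lemma sum_spines_atS : \sum_(0 <= x < w) k x.+1 = z'.
Proof. by rewrite -sum_nat_shift ?sum_spines_at ?spines_at_first ?spines_at_last. Qed.

Local Notation bt := (reduced w h a S).

(** The number of runs of a column exceeds the number of spines of either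
    adjacent column, so the profile still climbs when the spines of the higher
    column are subtracted. *)
Lemma col_outer_up x : x < w -> u x.+1 -> bt x < bt x.+1 /\ beta x + k x.+1 < beta x.+1.
Proof.
move=> xw ux; have := spines_lt_tops xw; have := col_innerE cfg x.
rewrite (col_inner_open_right cfg ux) /reduced; lia.
Qed.

Lemma col_outer_down x : x.+1 < w -> ~~ u x.+1 -> bt x.+1 < bt x /\ beta x.+1 + k x < beta x.
Proof.
move=> xw ux; have := spines_lt_tops xw; have := col_innerE cfg x.+1.
rewrite (col_inner_open_left cfg ux) /reduced spines_leftS; lia.
Qed.

Lemma spines_le_outer x : k x <= beta x.
Proof.
case: (posnP (k x)) => [->//|/spine_peak[]]; case: x => // x xw /andP[ux _].
have := col_outer_up _ ux; lia.
Qed.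

(** A column with a spine is a peak, and its outer cells outnumber its
    spines. *)
Lemma reduced_eq0 x : (bt x == 0) = (beta x == 0).
Proof.
apply/idP/idP; last by rewrite /reduced => /eqP ->.
case: (posnP (k x)) => [|/spine_peak[]]; first by rewrite /reduced => ->; rewrite subn0.
by case: x => // x xw /andP[ux _]; have [] := col_outer_up _ ux; lia.
Qed.

Lemma reduced_ends : bt 0 = 0 /\ bt w.-1 = 0.
Proof. by rewrite /reduced (col_outer_first cfg) (col_outer_last cfg). Qed.

Lemma reduced_neq x : x < w.-1 -> bt x != bt x.+1.
Proof.
move=> xw; case ux: (u x.+1); first by have [] := col_outer_up (x := x) _ ux; lia.
by have [] := col_outer_down (x := x) _ (negbT ux); lia.
Qed.

(** Two different natural numbers have sum at least 3 unless one of them is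
    zero, in which case they have sum at least 1. *)
Lemma reduced_pair x : x < w.-1 -> 3 <= bt x + bt x.+1 + 2 * ((bt x == 0) + (bt x.+1 == 0)).
Proof. by move=> /reduced_neq; lia. Qed.

Lemma sum_pairs n (f : nat -> nat) :
  \sum_(0 <= x < n) (f x + f x.+1) + f 0 + f n = 2 * \sum_(0 <= x < n.+1) f x.
Proof.
elim: n => [|n IH]; first by rewrite big_nil big_nat1; lia.
by rewrite big_nat_recr //= [in RHS]big_nat_recr //=; lia.
Qed.

(** The reduced profile vanishes at the bottlenecks and in the first and the
    last column. *)
Lemma sum_reduced_zeros : \sum_(0 <= x < w) (bt x == 0) = z + 2.
Proof.
have -> : \sum_(0 <= x < w) (bt x == 0) =
    \sum_(0 <= x < w) (bottleneck w h a S x + (0 == x) + (w.-1 == x)).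
  apply: eq_big_nat => x /andP[_ xw]; rewrite reduced_eq0 /bottleneck.
  have := col_outer_first cfg; have := col_outer_last cfg.
  have [->|x0] := posnP x; first by move=> _ ->; lia.
  have [->|xl] := eqVneq x w.-1; first by move=> ->; lia.
  by move=> _ _; lia.
by rewrite !big_split /= !sum_nat_pred1 /bottlenecks; lia.
Qed.

Lemma sum_reduced_pairs :
  \sum_(0 <= x < w.-1) (bt x + bt x.+1 + 2 * ((bt x == 0) + (bt x.+1 == 0)))
    = 2 * \sum_(0 <= x < w) bt x + 4 * z + 4.
Proof.
rewrite big_split /= -big_distrr /=.
have := sum_pairs w.-1 bt; have := sum_pairs w.-1 (fun x => nat_of_bool (bt x == 0)).
have [-> ->] := reduced_ends; rewrite prednK ?sum_reduced_zeros; lia.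
Qed.

Lemma sum_col_outer : \sum_(0 <= x < w) beta x = \sum_(0 <= x < w) bt x + z'.
Proof.
rewrite -sum_spines_at -big_split /=; apply: eq_bigr => x _.
by rewrite /reduced subnK // spines_le_outer.
Qed.

Lemma sum_spines_bound : \sum_(0 <= x < w) (kl x + k x.+1).+1 = w + 2 * z'.
Proof.
under eq_bigr do rewrite -addn1.
by rewrite !big_split /= sum_spines_left sum_spines_atS sum_nat_const_nat; lia.
Qed.

Lemma leq_sum_nat n (f g : nat -> nat) : (forall x, x < n -> f x <= g x) ->
  \sum_(0 <= x < n) f x <= \sum_(0 <= x < n) g x.
Proof. by move=> fg; rewrite !big_mkord; apply: leq_sum => i _; apply: fg. Qed.

(** The estimates of [reduced_pair] and [spines_lt_tops], summed over all
    columns.  The bottleneck columns weaken the bound by as much as the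
    bottleneck rows strengthen it. *)
Lemma cell_count_lower : 4 * w + 4 * z' <= cell_count w h S + 4 * z + 7.
Proof.
rewrite (cell_countE cfg) sum_col_outer.
have := leq_sum_nat reduced_pair; rewrite sum_reduced_pairs sum_nat_const_nat.
have := leq_sum_nat spines_lt_tops; rewrite sum_spines_bound; lia.
Qed.

Lemma cell_count_tight : cell_count w h S + 4 * z + 7 = 4 * w + 4 * z' ->
  (forall x, x < w.-1 -> bt x + bt x.+1 + 2 * ((bt x == 0) + (bt x.+1 == 0)) = 3) /\
  (forall x, x < w -> tops x = (kl x + k x.+1).+1).
Proof.
rewrite (cell_countE cfg) sum_col_outer => E.
have le1 := leq_sum_nat reduced_pair; have le2 := leq_sum_nat spines_lt_tops.
move: (le1) (le2); rewrite sum_reduced_pairs sum_nat_const_nat sum_spines_bound => le1' le2'.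
split=> x xw.
  apply/esym/(sum_nat_eq_pointwise reduced_pair) => //.
  by rewrite sum_reduced_pairs sum_nat_const_nat; lia.
by apply/esym/(sum_nat_eq_pointwise spines_lt_tops) => //; rewrite sum_spines_bound; lia.
Qed.

End LowerBound.

(** The error terms of the bound and of its transpose cancel. *)
Theorem cell_count_ge w h a u t S : config w h a u t S -> (3 <= w)%N -> (3 <= h)%N ->
  (2 * (w + h) <= cell_count w h S + 7)%N.
Proof.
move=> cfg w3 h3; have := cell_count_lower cfg w3 h3.
have := cell_count_lower (config_transpose cfg) h3 w3.
rewrite cell_count_transpose.
have -> : transpose (transpose S) = S by [].
lia.
Qed.

(** * The extremal regions of width and height at least 5 *)

(** The types of the lines of a cross whose central column is [p]: they
    alternate, except that the two lines around column [p] are exchanged. *)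
Definition cross_type (n p : nat) (u : nat -> bool) : Prop :=
  forall j, (0 < j < n)%N -> u j = odd j (+) ((j == p) || (j == p.+1)).

Section Tight.
Variables (w h : nat) (a : bool) (u t : nat -> bool) (S : nat -> nat -> bool).
Hypothesis cfg : config w h a u t S.
Hypotheses (w_ge5 : (5 <= w)%N) (h_ge5 : (5 <= h)%N) (w_odd : odd w).
Local Open Scope nat_scope.
Let w_ge3 : 3 <= w := leq_trans (isT : 3 <= 5) w_ge5.
Let h_ge3 : 3 <= h := leq_trans (isT : 3 <= 5) h_ge5.

Local Notation beta := (col_outer h a S).
Local Notation tops := (col_tops h S).
Local Notation bt := (reduced w h a S).
Local Notation k := (spines_at w h a S).
Local Notation kl := (spines_left w h a S).
Local Notation pinched := (bottleneck h w a (transpose S)).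

Hypothesis tight_pair : forall x, x < w.-1 ->
  bt x + bt x.+1 + 2 * ((bt x == 0) + (bt x.+1 == 0)) = 3.
Hypothesis tight_tops : forall x, x < w -> tops x = (kl x + k x.+1).+1.

(** In the extremal case every gap is made by a spine. *)
Lemma tight_gap x y : x < w -> S x y -> ~~ S x y.+1 -> S x y.+2 -> pinched y.+1.
Proof.
move=> xw S0 S1 S2.
have le_gaps : gaps h S x <= kl x + k x.+1.
  by have := gaps_lt_tops cfg xw; rewrite tight_tops.
rewrite spines_gapsE // in le_gaps.
have yh : y < h by case/andP: (cfg_box cfg S0).
have := sum_nat_eq_pointwise (fun i _ => spines_le_gap cfg w_ge3 h_ge3 x i) le_gaps yh.
rewrite S0 S1 S2 /=; case: (pinched y.+1) => //.
Qed.

(** Equality in [reduced_pair] leaves only the pairs 0, 1 and 1, 2, in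
    either order. *)
Lemma tight_parity x : x < w -> bt x <= 2 /\ odd (bt x) = odd x.
Proof.
elim: x => [|x IH] xw; first by have [-> _] := reduced_ends cfg.
have [b2 bo] := IH (ltnW xw).
have x1 : x < w.-1 by lia.
by have := tight_pair x1; move: bo => /=; lia.
Qed.

Lemma tight_odd x : x < w -> odd x -> bt x = 1.
Proof. by move=> xw ox; have [] := tight_parity xw; lia. Qed.

Lemma tight_even x : x < w -> ~~ odd x -> bt x = 0 \/ bt x = 2.
Proof. by move=> xw ox; have [] := tight_parity xw; lia. Qed.

Lemma col_outerE x : beta x = bt x + k x.
Proof. by rewrite /reduced subnK // (spines_le_outer cfg). Qed.

Lemma open_of_lt x : x < w.-1 -> u x.+1 = (bt x < bt x.+1).
Proof.
move=> xw; case ux: (u x.+1).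
  by have [] := col_outer_up cfg w_ge3 h_ge3 (x := x) _ ux; lia.
by have [] := col_outer_down cfg w_ge3 h_ge3 (x := x) _ (negbT ux); lia.
Qed.

(** The cells of a bottleneck column are as many as the outer cells of the
    next column, 1 plus the spines there, and also as many as its runs, 1 plus
    the spines on both sides; so there are none on the other side. *)
Lemma tight_valley x : 0 < x < w.-1 -> bt x = 0 -> kl x = 0 /\ k x.+1 = 0.
Proof.
case: x => // x /andP[_ xw] b0.
have bb : beta x.+1 = 0 by apply/eqP; rewrite -(reduced_eq0 cfg) ?b0.
have [x1w x2w] : x < w /\ x.+2 < w by lia.
have ox : odd x by have [] := tight_parity (x := x.+1) _; rewrite ?b0 /=; lia.
have u1 : ~~ u x.+1 by rewrite open_of_lt ?(tight_odd x1w) ?b0 //; lia.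
have u2 : u x.+2 by rewrite open_of_lt ?(tight_odd x2w) ?b0 //=; lia.
have := col_innerE cfg x.+1; rewrite bb tight_tops; last by lia.
have := col_inner_open_left cfg u1; have := col_inner_open_right cfg u2.
by rewrite spines_leftS !col_outerE (tight_odd x1w) // (tight_odd x2w) //=; lia.
Qed.

(** A spine in an odd column would need bottlenecks or ends on both sides;
    an interior bottleneck excludes it, and the two ends are too far apart. *)
Lemma tight_odd_spine x : x < w -> odd x -> k x = 0.
Proof.
move=> xw ox; case: (posnP (k x)) => // /[dup] kx /(spine_peak cfg)[] //.
case: x xw ox kx => // x xw ox kx xb /andP[u1 u2].
have b1 := tight_odd xw ox.
rewrite open_of_lt ?b1 in u1; last by lia.
rewrite open_of_lt ?b1 in u2; last by lia.
have [x2|x2] := ltnP x.+2 w.-1.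
  have b2 : bt x.+2 = 0 by have := @tight_even x.+2; rewrite /= in ox *; lia.
  by have [|] := tight_valley _ b2.
have b0 : bt x = 0 by lia.
have xv : 0 < x < w.-1 by lia.
by have [] := tight_valley xv b0.
Qed.

(** So each odd column has a single outer cell; by [tight_step] these
    cells are all in the same row. *)
Lemma tight_odd_outer x : x < w -> odd x -> beta x = 1.
Proof. by move=> xw ox; rewrite col_outerE tight_odd // tight_odd_spine. Qed.

(** The column in between is a valley or a peak.  In a valley the cells of
    row [y] propagate directly.  Over a peak the cells above and below do; if
    row [y] itself had none, this would be a gap, hence a bottleneck row with an
    outer cell. *)
Lemma tight_step x y : x.+2 < w -> odd x -> S x y -> ~~ inner a x y -> S x.+2 y.
Proof.
move=> xw ox Sxy nA.
have [x0w x1w] : x < w.-1 /\ x.+1 < w.-1 by lia.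
have b0 := tight_odd (ltnW (ltnW xw)) ox; have b2 : bt x.+2 = 1 by apply: tight_odd; rewrite /= ?negbK.
have u1 := open_of_lt x0w; have u2 := open_of_lt x1w.
have [] := @tight_even x.+1 _ _; [lia | by rewrite /= ox | |] => b1;
  rewrite b0 b1 b2 /= in u1 u2.
  rewrite -(cfg_hopen cfg) ?u2 ?innerSl ?nA //.
  by rewrite -(cfg_hopen cfg) // u1 (negbTE nA).
(* Inner cells pass from column [x] to column [x.+2] over the peak. *)
have row2 y' : inner a x y' -> S x y' -> S x.+2 y'.
  move=> A Sxy'; rewrite -(cfg_hopen cfg) ?u2 ?innerSl ?A //.
  by rewrite -(cfg_hopen cfg) // u1 A.
have /andP[y0 _] := outer_row_gt0 cfg Sxy nA.
case: y y0 nA Sxy => // y _ nA Sxy.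
have S2 : S x.+2 y.
  by apply: row2; [move: nA; rewrite innerSr negbK | exact: (outer_down cfg)].
have S2' : S x.+2 y.+2.
  by apply: row2; [rewrite innerSr | exact: (outer_up cfg)].
apply/negPn/negP => nS.
have pin := tight_gap xw S2 nS S2'.
by move: nA; rewrite (pinched_inner cfg pin Sxy).
Qed.

Lemma tight_full_row : exists Y, forall x, x < w -> odd x -> S x Y && ~~ inner a x Y.
Proof.
have b1 : beta 1 != 0 by rewrite tight_odd_outer //; lia.
have [Y /andP[S1 A1]] : exists Y, S 1 Y && ~~ inner a 1 Y.
  have [/hasP[Y _ SY]|/hasPn H] := boolP (has (fun y => S 1 y && ~~ inner a 1 y) (index_iota 0 h)).
    by exists Y.
  by case/eqP: b1; rewrite /col_outer big1_seq // => y /andP[_ /H /negbTE ->].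
exists Y; elim/ltn_ind => -[|[|[|x]]] // IH xw ox; first by rewrite S1 A1.
have ox1 : odd x.+1 by move: ox; rewrite /= !negbK.
have /andP[Sx Ax] := IH x.+1 (leqnSn _) (ltnW (ltnW xw)) ox1.
by rewrite (tight_step xw ox1 Sx Ax) 2!innerSl negbK.
Qed.

(** The type of a line is read off from the profile, which is 1 at the odd
    columns and, at the even ones, 0 except for the value 2 at [X]. *)
Lemma tight_cross_type X : 0 < X < w.-1 -> ~~ odd X -> 2 <= beta X ->
  (forall x, x < w -> ~~ odd x -> x != X -> beta x = 0) -> cross_type w X u.
Proof.
move=> Xb eX bX b0 [//|i] /andP[_ iw]; rewrite open_of_lt; last by lia.
have iw' : i < w by lia.
have btX : bt X = 2.
  have Xw : X < w by lia.
  have [/eqP|//] := tight_even Xw eX; rewrite (reduced_eq0 cfg) //; lia.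
have [oi|ei] := boolP (odd i).
  rewrite (tight_odd iw' oi) /= oi /= eqSS.
  have -> : (i == X) = false by apply/negP => /eqP E; rewrite -E oi in eX.
  rewrite orbF; have [->|nX] := eqVneq i.+1 X; first by rewrite btX.
  have ei1 : ~~ odd i.+1 by rewrite /= oi.
  have /eqP -> // : bt i.+1 == 0 by rewrite (reduced_eq0 cfg) // b0.
rewrite (@tight_odd i.+1) //= (negbTE ei) /= eqSS.
have -> : (i.+1 == X) = false by apply/negP => /eqP E; rewrite -E /= ei in eX.
rewrite /=; have [->|nX] := eqVneq i X; first by rewrite btX.
by have /eqP -> : bt i == 0 by rewrite (reduced_eq0 cfg) // b0.
Qed.
End Tight.

Lemma extremal_tight w h a u t S : config w h a u t S -> (3 <= w)%N -> (3 <= h)%N ->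
  (cell_count w h S + 7 = 2 * (w + h))%N ->
  (cell_count w h S + 4 * bottlenecks w h a S + 7
     = 4 * w + 4 * bottlenecks h w a (transpose S))%N.
Proof.
move=> cfg w3 h3; have := cell_count_lower cfg w3 h3.
have := cell_count_lower (config_transpose cfg) h3 w3.
rewrite cell_count_transpose.
have -> : transpose (transpose S) = S by [].
lia.
Qed.

Lemma two_outer_cells w h a u t S x y1 y2 : config w h a u t S -> S x y1 -> S x y2 ->
  ~~ inner a x y1 -> ~~ inner a x y2 -> y1 != y2 -> (2 <= col_outer h a S x)%N.
Proof.
move=> cfg S1 S2 A1 A2 neq.
have /andP[_ h1] := cfg_box cfg S1; have /andP[_ h2] := cfg_box cfg S2.
have -> : 2%N = (\sum_(0 <= y < h) ((y1 == y) + (y2 == y)))%N.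
  by rewrite big_split /= !sum_nat_pred1 h1 h2.
apply: leq_sum_nat => y _; have [<-|n1] := eqVneq y1 y.
  by rewrite S1 A1 eq_sym (negbTE neq).
by have [<-|//] := eqVneq y2 y; rewrite S2 A2.
Qed.

(** Let [Y] be the row of the outer cells of the odd columns and [X] the column
    of the outer cells of the odd rows.  Row [Y] has at least two outer cells, so
    it is not odd; this fixes the colour of the outer cells.  Then an outer cell
    in an even column lies in an odd row, whose only outer cell is in column
    [X]. *)
Theorem extremal_cross w h a u t S : config w h a u t S ->
  (5 <= w)%N -> (5 <= h)%N -> odd w -> odd h ->
  (cell_count w h S + 7 = 2 * (w + h))%N ->
  exists p q, [/\ ~~ odd p, ~~ odd q, (0 < p < w.-1)%N & (0 < q < h.-1)%N] /\
    [/\ a = false, cross_type w p u & cross_type h q t].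
Proof.
move=> cfg w5 h5 wo ho ext.
have cfgT := config_transpose cfg.
have w3 : (3 <= w)%N by lia.
have h3 : (3 <= h)%N by lia.
have extT : (cell_count h w (transpose S) + 7 = 2 * (h + w))%N.
  by rewrite cell_count_transpose; lia.
have [tp tt] := cell_count_tight cfg w3 h3 (extremal_tight cfg w3 h3 ext).
have [tpT ttT] := cell_count_tight cfgT h3 w3 (extremal_tight cfgT h3 w3 extT).
have [Y fullY] := tight_full_row cfg w5 h5 wo tp tt.
have [X fullX] := tight_full_row cfgT h5 w5 ho tpT ttT.
have one_w : (1 < w)%N by lia.
have one_h : (1 < h)%N by lia.
have three_w : (3 < w)%N by lia.
have three_h : (3 < h)%N by lia.
have /andP[S1Y A1Y] := fullY 1%N one_w isT; have /andP[S3Y A3Y] := fullY 3%N three_w isT.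
have /andP[SX1 AX1] := fullX 1%N one_h isT; have /andP[SX3 AX3] := fullX 3%N three_h isT.
have Yb := outer_row_gt0 cfg S1Y A1Y; have Xb := outer_row_gt0 cfgT SX1 AX1.
have eY : ~~ odd Y.
  apply/negP => oY; have Yh : (Y < h)%N by lia.
  have := tight_odd_outer cfgT h5 w5 ho tpT ttT Yh oY.
  by have := two_outer_cells cfgT (x := Y) S1Y S3Y; rewrite !(innerC a Y) A1Y A3Y => /(_ isT isT isT) /[swap] ->.
have eX : ~~ odd X.
  apply/negP => oX; have Xw : (X < w)%N by lia.
  have := tight_odd_outer cfg w5 h5 wo tp tt Xw oX.
  by have := two_outer_cells cfg (x := X) SX1 SX3; rewrite !(innerC a X) AX1 AX3 => /(_ isT isT isT) /[swap] ->.
have a0 : a = false by move: A1Y; rewrite /inner add1n /= eY; case: (a).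
exists X, Y; split; split=> //.
  apply: (tight_cross_type cfg w5 h5 wo tp) => //.
    by apply: (two_outer_cells cfg SX1 SX3); rewrite // innerC.
  move=> x xw ex nX; apply/eqP/(col_outer_eq0P cfg) => y Sxy; apply/negPn/negP => A.
  have /andP[_ yh] := cfg_box cfg Sxy.
  have oy : odd y by move: A; rewrite /inner a0 oddD (negbTE ex) /=; case: (odd y).
  have /andP[SXy AXy] := fullX _ yh oy.
  have := tight_odd_outer cfgT h5 w5 ho tpT ttT yh oy.
  have Ay : ~~ inner a y x by rewrite innerC.
  by have := two_outer_cells cfgT (Sxy : transpose S y x) SXy Ay AXy nX => /[swap] ->.
apply: (tight_cross_type cfgT h5 w5 ho tpT) => //.
  by apply: (two_outer_cells cfgT S1Y S3Y); rewrite // innerC.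
move=> y yh ey nY; apply/eqP/(col_outer_eq0P cfgT) => x Sxy; apply/negPn/negP => A.
have /andP[_ xw] := cfg_box cfgT Sxy.
have ox : odd x by move: A; rewrite /inner a0 oddD (negbTE ey) /=; case: (odd x).
have /andP[SxY AxY] := fullY _ xw ox.
have := tight_odd_outer cfg w5 h5 wo tp tt xw ox.
have Ax : ~~ inner a x y by rewrite innerC.
by have := two_outer_cells cfg (Sxy : S x y) SxY Ax AxY nY => /[swap] ->.
Qed.

(** * Width 3, and the crosses *)

Lemma sum_odd_weight n : (\sum_(0 <= y < n) (if odd y then 3 else 1) = 2 * n - odd n)%N.
Proof.
elim: n => [|n IH]; first by rewrite big_nil.
by rewrite big_nat_recr //= IH; case: (boolP (odd n)) => on; lia.
Qed.

(** The first and the last column of a region of width 3 have only inner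
    cells, so the rows have 3 cells and 1 cell in turn. *)
Theorem cell_count_thin h a u t S : config 3 h a u t S -> (3 <= h)%N -> odd h ->
  (cell_count 3 h S + 7 = 2 * (3 + h))%N.
Proof.
move=> cfg h3 ho.
have b0 := col_outer_first cfg; have b2 : col_outer h a S 2 = 0%N := col_outer_last cfg.
have a1 := @col_inner_gt0 _ _ _ _ _ _ cfg 1 isT.
have u1 : u 1%N.
  by apply/negPn/negP => /(col_inner_open_left cfg); rewrite b0 => E; rewrite E in a1.
have u2 : u 2%N = false.
  by apply/negP => /(col_inner_open_right cfg); rewrite b2 => E; rewrite E in a1.
have row_in y : (y < h)%N -> inner a 0 y -> [/\ S 0%N y, S 1%N y & S 2%N y].
  move=> /(cfg_row cfg)[x Sxy] A.
  have E1 : S 0%N y = S 1%N y by apply: (cfg_hopen cfg); rewrite u1 A.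
  have E2 : S 1%N y = S 2%N y by apply: (cfg_hopen cfg); rewrite u2 innerSl A.
  have S2 : S 2%N y.
    by move: x Sxy => [|[|[|x]]]; rewrite ?E1 ?E2 // => /(cfg_box cfg).
  by rewrite E1 E2 S2.
have row_out y : (y < h)%N -> ~~ inner a 0 y -> [/\ S 0%N y = false, S 1%N y & S 2%N y = false].
  move=> yh A.
  have S0 : S 0%N y = false by apply/negP => /(cfg_left cfg); apply/negP.
  have S2 : S 2%N y = false.
    by apply/negP => /(outer_right cfg); rewrite !innerSl negbK => /(_ A)/(cfg_box cfg).
  split=> //; have [x Sxy] := cfg_row cfg yh.
  case: x Sxy => [|[|[|x]]] //; rewrite ?S0 ?S2 //.
  by move/(cfg_box cfg).
have in00 : inner a 0 0 = false.
  case A: (inner a 0 0) => //; have [_ /(cfg_bottom cfg) S10 _] := row_in 0%N (ltnW (ltnW h3)) A.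
  by move: S10; rewrite innerSl A.
rewrite -cell_count_transpose.
rewrite /cell_count (_ : (\sum_(0 <= y < h) _)%N = (\sum_(0 <= y < h) (if odd y then 3 else 1))%N).
  by rewrite sum_odd_weight ho; lia.
apply: eq_big_nat => y /andP[_ yh]; rewrite unlock /= /transpose.
have Ay : inner a 0 y = odd y by move: in00; rewrite /inner !add0n; case: (odd y); case: (a).
have [oy|ey] := boolP (odd y).
  by have [|-> -> ->] := row_in y yh; rewrite ?Ay.
by have [|-> -> ->] := row_out y yh; rewrite ?Ay.
Qed.

Definition cross_shape (p q x y : nat) : bool :=
  [|| y == q, x == p | [&& odd x, odd y & [|| x.+1 == p, x == p.+1, y.+1 == q | y == q.+1]]].

Lemma cross_type_even n p u j :
  cross_type n p u -> ~~ odd p -> (0 < j < n)%N -> ~~ odd j -> u j = (j == p).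
Proof.
move=> uc ep jn ej; rewrite uc // (negbTE ej) /=.
by have -> : (j == p.+1) = false; [apply/negP => /eqP E; rewrite E /= ep in ej | rewrite orbF].
Qed.

Lemma cross_type_odd n p u j :
  cross_type n p u -> ~~ odd p -> (0 < j < n)%N -> odd j -> u j = (j != p.+1).
Proof.
move=> uc ep jn oj; rewrite uc // oj /=.
by have -> : (j == p) = false; [apply/negP => /eqP E; rewrite -E oj in ep | rewrite /=].
Qed.

Section Cross.
Variables (w h p q : nat) (u t : nat -> bool) (S : nat -> nat -> bool).
Hypothesis cfg : config w h false u t S.
Hypotheses (w_odd : odd w) (h_odd : odd h).
Hypotheses (p_even : ~~ odd p) (q_even : ~~ odd q).
Hypotheses (p_lt : (0 < p < w.-1)%N) (q_lt : (0 < q < h.-1)%N).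
Hypotheses (u_cross : cross_type w p u) (t_cross : cross_type h q t).
Local Open Scope nat_scope.

Lemma inner_false x y : inner false x y = (odd x == odd y).
Proof. by rewrite /inner oddD; case: (odd x); case: (odd y). Qed.

(** Away from column [p] the lines let the cells of an even row pass
    to the left until column 0; [even_row_right] does the same on the other
    side. *)
Lemma even_row_left x y : S x y -> ~~ odd x -> ~~ odd y -> x < p -> S 0 y.
Proof.
elim/ltn_ind: x => -[|[|x]] // IH Sxy ex2 ey xp.
have ex : ~~ odd x by move: ex2; rewrite /= negbK.
have x2w : 0 < x.+2 < w by lia.
have ux : u x.+2 = false by rewrite (cross_type_even u_cross) // ltn_eqF.
have S1 : S x.+1 y by rewrite (cfg_hopen cfg) // ux inner_false /= ex (negbTE ey).
apply: (IH x) => //; last by lia.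
by apply: (outer_left cfg) S1 _; rewrite inner_false /= ex (negbTE ey).
Qed.

Lemma even_row_right x y : S x y -> ~~ odd x -> ~~ odd y -> p < x -> S w.-1 y.
Proof.
have [n] := ubnP (w - x); elim: n x => // n IH x wx Sxy ex ey px.
have /andP[xw _] := cfg_box cfg Sxy.
have [->//|xl] := eqVneq w.-1 x.
have x1w : 0 < x.+1 < w by lia.
have ox1 : odd x.+1 by [].
have ux : u x.+1 by rewrite (cross_type_odd u_cross) // eqSS gtn_eqF.
have S1 : S x.+1 y.
  by rewrite -(cfg_hopen cfg) // ux inner_false (negbTE ex) (negbTE ey).
have S2 : S x.+2 y.
  by apply: (outer_right cfg) S1 _; rewrite inner_false ox1 (negbTE ey).
apply: (IH x.+2) => //; [lia | by rewrite /= negbK | lia].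
Qed.

(** In the first and in the last column there are no outer cells, so a cell
    of an even row there has to be vertically closed. *)
Lemma even_row_ends x y : (x == 0) || (x == w.-1) -> ~~ odd y -> S x y -> y = q.
Proof.
move=> ends ey Sxy; have /andP[xw yh] := cfg_box cfg Sxy.
have ex : ~~ odd x.
  by case/orP: ends => /eqP -> //; have := w_odd; rewrite -{1}[w]prednK //; lia.
have [//|nq] := eqVneq y q.
suff [y' [S' A']] : exists y', S x y' /\ ~~ inner false x y'.
  by have := outer_col_gt0 cfg S' A'; lia.
have [y0|y0] := posnP y.
  exists y.+1; split; last by rewrite inner_false /= (negbTE ex) ey.
  have yw : 0 < y.+1 < h by lia.
  rewrite -(cfg_vopen cfg) // (cross_type_odd t_cross) //.
  by rewrite eqSS inner_false (negbTE ex) (negbTE ey).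
case: y ey Sxy yh nq y0 => // y ey Sxy yh nq _.
have oy : odd y by move: ey; rewrite /= negbK.
exists y; split; last by rewrite inner_false oy (negbTE ex).
by rewrite (cfg_vopen cfg) // (cross_type_even t_cross) // inner_false oy (negbTE ex) (negbTE nq).
Qed.

(** A cell with even coordinates that is neither in column [p] nor in row
    [q] would propagate to the boundary of the box and leave it there. *)
Lemma even_even x y : S x y -> ~~ odd x -> ~~ odd y -> x = p \/ y = q.
Proof.
move=> Sxy ex ey; have [xp|xp|->] := ltngtP x p; [right|right|by left].
  by apply: (even_row_ends (x := 0)) => //; apply: even_row_left Sxy _ _ _.
by apply: (even_row_ends (x := w.-1)); rewrite ?eqxx ?orbT //; apply: even_row_right Sxy _ _ _.
Qed.

(** The neighbours of an outer cell in an odd column lie in two even columns,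
    and only one of these can be column [p]. *)
Lemma odd_even x y : S x y -> odd x -> ~~ odd y -> y = q.
Proof.
case: x => // x Sxy ox ey.
have A : ~~ inner false x.+1 y by rewrite inner_false ox (negbTE ey).
have ex : ~~ odd x by [].
have ex2 : ~~ odd x.+2 by rewrite /= negbK.
have [E1|//] := even_even (outer_left cfg Sxy A) ex ey.
have [E2|//] := even_even (outer_right cfg Sxy A) ex2 ey.
by lia.
Qed.

(** Row [q] has a cell at each end of the box, from where the open lines
    carry it to column [p]. *)
Lemma row_full x : x < w -> S x q.
Proof.
move=> xw.
have [w0 w1] : 0 < w /\ w.-1 < w by lia.
have S0 : S 0 q.
  have [y Sy] := cfg_col cfg w0.
  have ey : ~~ odd y by have := cfg_left cfg Sy; rewrite inner_false /=; case: (odd y).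
  by rewrite -(even_row_ends _ ey Sy).
have Sl : S w.-1 q.
  have [y Sy] := cfg_col cfg w1.
  have ey : ~~ odd y.
    have : inner false w.-1 y by apply/negPn/negP => /(outer_col_gt0 cfg Sy); lia.
    rewrite inner_false; have -> : odd w.-1 = false by lia.
    by case: (odd y).
  by rewrite -(even_row_ends _ ey Sy) ?eqxx ?orbT.
have from_left m : ~~ odd m -> m <= p -> S m q /\ (m < p -> S m.+1 q).
  have step i : ~~ odd i -> i < p -> S i q -> S i.+1 q.
    move=> ei ip Si; have iw : 0 < i.+1 < w by lia.
    rewrite -(cfg_hopen cfg) // (cross_type_odd u_cross) // inner_false (negbTE ei) (negbTE q_even).
    by rewrite eqSS ltn_eqF.
  elim/ltn_ind: m => -[|[|m]] // IH em2 mp; first by split=> // ?; apply: step.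
  have em : ~~ odd m by move: em2; rewrite /= negbK.
  have [_ Sm1] := IH m (leqW (leqnn _)) em (ltnW (ltnW mp)).
  have A : ~~ inner false m.+1 q by rewrite inner_false /= em (negbTE q_even).
  have S2 : S m.+2 q by apply: (outer_right cfg) A; apply: Sm1; lia.
  by split=> // ?; apply: step.
have from_right m : ~~ odd m -> p <= m < w -> S m q /\ (p < m -> S m.-1 q).
  have step i : ~~ odd i -> p < i < w -> S i q -> S i.-1 q.
    case: i => // i ei pi Si; have oi : odd i by move: ei; rewrite /= negbK.
    have iw : 0 < i.+1 < w by lia.
    rewrite (cfg_hopen cfg) // (cross_type_even u_cross) // inner_false oi (negbTE q_even).
    by rewrite gtn_eqF //; lia.
  have [n] := ubnP (w - m); elim: n m => // n IH m wm em pm.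
  have Sm : S m q.
    have [<-//|ml] := eqVneq w.-1 m.
    have m2 : p <= m.+2 < w.
      suff : m.+1 != w.-1 by lia.
      by apply/eqP => E; have : odd w.-1; [rewrite -E /= em | lia].
    have wm2 : w - m.+2 < n by lia.
    have em2 : ~~ odd m.+2 by rewrite /= negbK.
    have [_ Sm1] := IH m.+2 wm2 em2 m2.
    have A : ~~ inner false m.+1 q by rewrite inner_false /= em (negbTE q_even).
    by apply: (outer_left cfg) A; apply: Sm1; lia.
  by split=> // pm'; apply: step => //; lia.
have [xp|px] := leqP x p.
  have [ox|ex] := boolP (odd x); last by have [] := from_left x ex xp.
  case: x ox xw xp => // x ox xw xp.
  have ex : ~~ odd x by [].
  by have [_ ->] := from_left x ex (ltnW xp).
have [ox|ex] := boolP (odd x); last by have [|//] := from_right x ex; lia.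
have ex : ~~ odd x.+1 by rewrite /= ox.
have x1w : p <= x.+1 < w.
  suff : x != w.-1 by lia.
  by apply/eqP => E; have : odd w.-1; [rewrite -E ox | lia].
by have [_ ->] := from_right x.+1 ex x1w; last by lia.
Qed.

End Cross.

(** The cells with both coordinates odd are inner, and without a neighbour in
    the region they would be unit squares of their own; so they are next to
    an outer cell, which is in row [q] or in column [p]. *)
Lemma cross_shapeE w h p q u t S :
  config w h false u t S -> odd w -> odd h -> ~~ odd p -> ~~ odd q ->
  (0 < p < w.-1)%N -> (0 < q < h.-1)%N -> cross_type w p u -> cross_type h q t ->
  (forall x y, S x y ->
    [|| S x.+1 y, S x y.+1, (0 < x)%N && S x.-1 y | (0 < y)%N && S x y.-1]) ->
  forall x y, (x < w)%N -> (y < h)%N -> S x y = cross_shape p q x y.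
Proof.
move=> cfg wo ho ep eq_ pl ql uc tc iso x y xw yh.
have cfgT := config_transpose cfg.
have rowq x' : (x' < w)%N -> S x' q := @row_full _ _ _ _ _ _ _ cfg wo ho ep eq_ pl ql uc tc x'.
have colp y' : (y' < h)%N -> S p y' := @row_full _ _ _ _ _ _ _ cfgT ho wo eq_ ep ql pl tc uc y'.
apply/idP/idP => [Sxy|].
  rewrite /cross_shape; have [ox|ex] := boolP (odd x); have [oy|ey] := boolP (odd y) => /=.
  - have := iso _ _ Sxy.
    have oe := odd_even cfg wo ho ep eq_ pl ql uc tc; have eo := odd_even cfgT ho wo eq_ ep ql pl tc uc.
    case/or4P => [S1|S1|/andP[x0 S1]|/andP[y0 S1]].
    + by have := eo _ _ S1 oy; rewrite /= ox => /(_ isT) <-; rewrite eqxx !orbT.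
    + by have := oe _ _ S1 ox; rewrite /= oy => /(_ isT) <-; rewrite eqxx !orbT.
    + by have := eo _ _ S1 oy; rewrite (_ : ~~ odd x.-1) => [/(_ isT) <-|]; [rewrite prednK // eqxx !orbT|lia].
    + by have := oe _ _ S1 ox; rewrite (_ : ~~ odd y.-1) => [/(_ isT) <-|]; [rewrite prednK // eqxx !orbT|lia].
  - by rewrite (odd_even cfg wo ho ep eq_ pl ql uc tc Sxy ox ey) eqxx.
  - by rewrite (odd_even cfgT ho wo eq_ ep ql pl tc uc Sxy oy ex) eqxx orbT.
  - by have [->|->] := even_even cfg wo ho ep eq_ pl ql uc tc Sxy ex ey; rewrite eqxx ?orbT.
case/or3P => [/eqP ->|/eqP ->|/and3P[ox oy]]; [exact: rowq|exact: colp|].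
case/or4P => /eqP E.
- by apply: (outer_left cfg); rewrite E ?colp // inner_false; lia.
- by rewrite E; apply: (outer_right cfg); rewrite ?colp // inner_false; lia.
- by apply: (outer_down cfg); rewrite E ?rowq // inner_false; lia.
- by rewrite E; apply: (outer_up cfg); rewrite ?rowq // inner_false; lia.
Qed.

Lemma sum_odd n : (\sum_(0 <= y < n) odd y = n./2)%N.
Proof.
elim: n => [|n IH]; first by rewrite big_nil.
by rewrite big_nat_recr //= IH uphalf_half addnC.
Qed.

Definition beside (p x : nat) : bool := odd x && ((x.+1 == p) || (x == p.+1)).

Lemma sum_beside n p : ~~ odd p -> (0 < p < n.-1)%N -> (\sum_(0 <= x < n) beside p x = 2)%N.
Proof.
move=> ep pn; transitivity (\sum_(0 <= x < n) ((p.-1 == x) + (p.+1 == x)))%N.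
  by apply: eq_bigr => x _; rewrite /beside; lia.
by rewrite big_split /= !sum_nat_pred1; lia.
Qed.

Lemma sum2_mul m n (f g : nat -> nat) :
  (\sum_(0 <= x < m) \sum_(0 <= y < n) f x * g y = (\sum_(0 <= x < m) f x) * \sum_(0 <= y < n) g y)%N.
Proof. by rewrite big_distrlr. Qed.

(** Inclusion and exclusion on the row, the column, and the two rows and two
    columns of bumps beside them; the overlaps are the centre and its four
    diagonal neighbours. *)
Lemma sum_cross_shape w h p q : odd w -> odd h -> ~~ odd p -> ~~ odd q ->
  (0 < p < w.-1)%N -> (0 < q < h.-1)%N ->
  (cell_count w h (cross_shape p q) + 7 = 2 * (w + h))%N.
Proof.
move=> wo ho ep eq_ pl ql.
have pointwise x y : (cross_shape p q x y + (p == x) * (q == y) + beside p x * beside q y =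
    (q == y) + (p == x) + beside p x * odd y + odd x * beside q y)%N.
  rewrite /cross_shape /beside (eq_sym p) (eq_sym q).
  have hx : (x == p) ==> ~~ odd x by apply/implyP => /eqP ->.
  have hy : (y == q) ==> ~~ odd y by apply/implyP => /eqP ->.
  move: hx hy; case: (x == p); case: (odd x) => //; case: (y == q); case: (odd y) => // _ _;
    by case: (x.+1 == p); case: (x == p.+1); case: (y.+1 == q); case: (y == q.+1).
have : (\sum_(0 <= x < w) \sum_(0 <= y < h) (cross_shape p q x y + (p == x) * (q == y) + beside p x * beside q y) =
   \sum_(0 <= x < w) \sum_(0 <= y < h) ((q == y) + (p == x) + beside p x * odd y + odd x * beside q y))%N.
  by apply: eq_bigr => x _; apply: eq_bigr => y _.
under eq_bigr do rewrite !big_split /=.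
under [in RHS]eq_bigr do rewrite !big_split /= sum_nat_pred1 sum_nat_const_nat.
rewrite !big_split /= !sum2_mul -big_distrr /= sum_nat_const_nat.
rewrite -/(cell_count w h (cross_shape p q)) !sum_nat_pred1 !sum_beside // !sum_odd.
lia.
Qed.

Theorem cell_count_cross w h p q u t S :
  config w h false u t S -> odd w -> odd h -> ~~ odd p -> ~~ odd q ->
  (0 < p < w.-1)%N -> (0 < q < h.-1)%N -> cross_type w p u -> cross_type h q t ->
  (forall x y, S x y ->
    [|| S x.+1 y, S x y.+1, (0 < x)%N && S x.-1 y | (0 < y)%N && S x y.-1]) ->
  (cell_count w h S + 7 = 2 * (w + h))%N.
Proof.
move=> cfg wo ho ep eq_ pl ql uc tc iso; rewrite -(sum_cross_shape wo ho ep eq_ pl ql).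
congr (_ + _)%N; apply: eq_big_nat => x /andP[_ xw]; apply: eq_big_nat => y /andP[_ yh].
by rewrite (cross_shapeE cfg wo ho ep eq_ pl ql uc tc iso).
Qed.

(** * The region enclosed by a closed chain of stitches *)

Definition oddz (k : int) : bool := odd `|k|%N.

Lemma oddzD m n : oddz (m + n) = oddz m (+) oddz n.
Proof. by rewrite /oddz; lia. Qed.

Lemma oddzS m : oddz (m + 1) = ~~ oddz m.
Proof. by rewrite oddzD addbT. Qed.

Lemma oddz_pred m : oddz (m - 1) = ~~ oddz m.
Proof. by rewrite oddzD addbT. Qed.

(** [H k i] and [V j k] say that the stitches with lower left end [(k, i)],
    respectively [(j, k)], belong to the loop, whose bounding box has lower left
    corner [(x0, y0)]; [e] and [f] are the labels of the lines.  Connectedness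
    is the principle that a two-colouring of the stitches that agrees at the
    vertices is constant; [H k' i] and [V k i'] are the stitches that meet at the
    vertex [(k, i)]. *)
Record loop_data (x0 y0 : int) (w h : nat) (e f : int -> bool)
    (H V : int -> int -> bool) : Prop := LoopData {
  ld_hlabel : forall k i, H k i -> oddz k = e i;
  ld_vlabel : forall j k, V j k -> oddz k = f j;
  ld_vertex : forall k i, H (k - 1) i || H k i = V k (i - 1) || V k i;
  ld_connected : forall phiH phiV : int -> int -> bool,
    (forall k i k' i', k' = k - 1 \/ k' = k -> i' = i - 1 \/ i' = i ->
       H k' i -> V k i' -> phiH k' i = phiV k i') ->
    exists c, (forall k i, H k i -> phiH k i = c) /\ (forall j k, V j k -> phiV j k = c);
  ld_hbox : forall k i, H k i -> x0 <= k < x0 + w%:Z /\ y0 <= i <= y0 + h%:Z;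
  ld_vbox : forall j k, V j k -> x0 <= j <= x0 + w%:Z /\ y0 <= k < y0 + h%:Z;
  ld_left : exists k, V x0 k;
  ld_right : exists k, V (x0 + w%:Z) k;
  ld_bottom : exists k, H k y0;
  ld_top : exists k, H k (y0 + h%:Z)
}.

Lemma loop_data_transpose x0 y0 w h e f H V : loop_data x0 y0 w h e f H V ->
  loop_data y0 x0 h w f e (fun i k => V k i) (fun i k => H k i).
Proof.
case=> hl vl vert conn hb vb l r b t; split=> //; eauto.
- move=> phiH phiV adj.
  have [|c [cH cV]] := conn (fun k i => phiV i k) (fun k i => phiH i k).
    by move=> k i k' i' kk ii Hk Vk; rewrite (adj i k i' k').
  by exists c; split=> [k i|j k]; [apply: cV | apply: cH].
- by move=> i k /vb[? ?].
- by move=> i k /hb[? ?].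
Qed.

Section Inside.
Variables (x0 y0 : int) (w h : nat) (e f : int -> bool) (H V : int -> int -> bool).
Hypothesis ld : loop_data x0 y0 w h e f H V.

Lemma ld_hexcl k i : ~~ (H (k - 1) i && H k i).
Proof.
apply/negP => /andP[/(ld_hlabel ld) o1 /(ld_hlabel ld) o2].
by move: o1; rewrite -o2 oddz_pred; case: oddz.
Qed.

Lemma ld_vexcl k i : ~~ (V k (i - 1) && V k i).
Proof.
apply/negP => /andP[/(ld_vlabel ld) o1 /(ld_vlabel ld) o2].
by move: o1; rewrite -o2 oddz_pred; case: oddz.
Qed.

Lemma ld_even k i : H (k - 1) i (+) H k i = V k (i - 1) (+) V k i.
Proof.
have := ld_vertex ld k i; have := ld_hexcl k i; have := ld_vexcl k i.
by case: (H (k - 1) i); case: (H k i); case: (V k (i - 1)); case: (V k i).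
Qed.

(** A cell is inside if an odd number of vertical stitches of the loop lies to
    its left in the same row. *)
Definition inside (x y : int) : bool :=
  (x0 <= x) && \big[addb/false]_(0 <= j < (absz (x - x0)).+1) V (x0 + j%:Z) y.

Lemma inside_left x y : x < x0 -> inside x y = false.
Proof. by rewrite /inside leNgt => ->. Qed.

(** The parity changes exactly across the stitches of the loop.  For vertical
    stitches this is the definition; for horizontal ones, [inside_hstep], it
    follows column by column because the number of stitches at each vertex is
    even. *)
Lemma inside_vstep x y : inside x y (+) inside (x - 1) y = V x y.
Proof.
have [xlt|xge] := ltP x x0.
  rewrite !inside_left //; last by lia.
  by apply/esym/negP => /(ld_vbox ld); lia.
have [n ->] : exists n : nat, x = x0 + n%:Z by exists (absz (x - x0)); lia.
case: n => [|n].
  rewrite (@inside_left (_ - 1)); last by lia.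
  rewrite /inside addr0 subrr lexx /= big_nat1 addr0 addbF //.
have -> : x0 + n.+1%:Z - 1 = x0 + n%:Z by lia.
rewrite /inside.
have -> : (x0 <= x0 + n.+1%:Z) by lia.
have -> : (x0 <= x0 + n%:Z) by lia.
have -> : absz (x0 + n.+1%:Z - x0)%R = n.+1 by lia.
have -> : absz (x0 + n%:Z - x0)%R = n by lia.
by rewrite big_nat_recr //= [X in X (+) _]addbC addbK.
Qed.

Lemma inside_hstep x y : inside x y (+) inside x (y - 1) = H x y.
Proof.
have [xlt|xge] := ltP x x0.
  rewrite !inside_left //.
  by apply/esym/negP => /(ld_hbox ld); lia.
have [n ->] : exists n : nat, x = x0 - 1 + n%:Z by exists (absz (x - x0 + 1)); lia.
elim: n => [|n IH].
  rewrite !inside_left; try lia.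
  by apply/esym/negP => /(ld_hbox ld); lia.
have := inside_vstep (x0 - 1 + n.+1%:Z) y; have := inside_vstep (x0 - 1 + n.+1%:Z) (y - 1).
have := ld_even (x0 - 1 + n.+1%:Z) y.
have -> : x0 - 1 + n.+1%:Z - 1 = x0 - 1 + n%:Z by lia.
by rewrite -IH; do 4!case: (inside _ _); case: (H _ _) => //; case: (V _ _) => //; case: (V _ _).
Qed.

Lemma inside_below x y : y < y0 -> inside x y = false.
Proof.
move=> yy; rewrite /inside big1 ?andbF // => j _.
by apply/negP => /(ld_vbox ld); lia.
Qed.

Lemma inside_above x y : y0 + h%:Z <= y -> inside x y = false.
Proof.
move=> yy; rewrite /inside big1 ?andbF // => j _.
by apply/negP => /(ld_vbox ld); lia.
Qed.

Lemma inside_right x y : x0 + w%:Z <= x -> inside x y = false.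
Proof.
move=> xw; have [yy|yy] := ltP y y0; first exact: inside_below.
have [n ->] : exists n : nat, y = y0 - 1 + n%:Z by exists (absz (y - y0 + 1)); lia.
elim: n => [|n IH]; first by rewrite inside_below //; lia.
have := inside_hstep x (y0 - 1 + n.+1%:Z).
have -> : H x (y0 - 1 + n.+1%:Z) = false by apply/negP => /(ld_hbox ld); lia.
have -> : y0 - 1 + n.+1%:Z - 1 = y0 - 1 + n%:Z by lia.
by rewrite IH addbF.
Qed.

Lemma inside_box x y : inside x y -> x0 <= x < x0 + w%:Z /\ y0 <= y < y0 + h%:Z.
Proof.
move=> ins; split.
  have [/inside_left E|xl] := ltP x x0; first by rewrite E in ins.
  by have [/inside_right E|//] := leP (x0 + w%:Z) x; rewrite E in ins.
have [/inside_below E|xl] := ltP y y0; first by rewrite E in ins.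
by have [/inside_above E|//] := leP (y0 + h%:Z) y; rewrite E in ins.
Qed.

Definition innerz (a : bool) (x y : int) : bool := (oddz x (+) oddz y) == a.

(** At a vertex the loop turns, and the two cells on the enclosed side of its
    two stitches there are equal or touch diagonally; in both cases they have
    the same colour.  So the colour is constant along the loop. *)
Lemma inner_side : exists a,
  (forall x y, H x y -> inside x y = innerz a x y) /\
  (forall x y, V x y -> inside x y = innerz a x y).
Proof.
have [|c [cH cV]] := ld_connected ld
  (phiH := fun x y => inside x y (+) (oddz x (+) oddz y))
  (phiV := fun x y => inside x y (+) (oddz x (+) oddz y)).
  move=> k i k' i' kk ii Hk Vk.
  have := inside_hstep k' i; have := inside_vstep k i'.
  have hs := inside_hstep; have vs := inside_vstep.
  case: kk Hk => -> Hk; case: ii Vk => -> Vk; rewrite Hk Vk ?oddz_pred //.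
  - do 2!case: (inside _ _) => //=; do 2!case: (inside _ _) => //=; by case: (oddz k); case: (oddz i).
  - have -> : inside k i = inside (k - 1) i (+) V k i by rewrite -inside_vstep addbC addbK.
    by rewrite Vk; do 2!case: (inside _ _) => //=; case: (oddz k); case: (oddz i).
  - have -> : inside k (i - 1) = inside k i (+) H k i by rewrite -inside_hstep addKb.
    by rewrite Hk; do 2!case: (inside _ _) => //=; case: (oddz k); case: (oddz i).
exists (~~ c); rewrite /innerz; split=> x y.
  by move/cH <-; case: inside; case: oddz; case: oddz.
by move/cV <-; case: inside; case: oddz; case: oddz.
Qed.


Lemma innerz_right a x y : innerz a (x + 1) y = ~~ innerz a x y.
Proof. by rewrite /innerz oddzS; case: (oddz x); case: (oddz y); case: a. Qed.

Lemma innerz_up a x y : innerz a x (y + 1) = ~~ innerz a x y.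
Proof. by rewrite /innerz oddzS; case: (oddz x); case: (oddz y); case: a. Qed.

(** Whether the stitches of the line have their inner cell on the side of the
    larger coordinate. *)
Definition line_type (a : bool) (lab : int -> bool) (z : int) : bool := (oddz z (+) lab z) == a.

Definition window (x y : nat) : bool := inside (x0 + x%:Z) (y0 + y%:Z).

Lemma inside_neq_v x y : inside x y != inside (x + 1) y -> V (x + 1) y.
Proof.
by move=> neq; rewrite -inside_vstep addrK; move: neq; do 2!case: (inside _ _).
Qed.

Lemma inside_neq_h x y : inside x y != inside x (y + 1) -> H x (y + 1).
Proof.
by move=> neq; rewrite -inside_hstep addrK; move: neq; do 2!case: (inside _ _).
Qed.

(** Without an enclosed cell there would be no horizontal stitch in the column,
    and the loop would be separated into the parts on its two sides. *)
Lemma column_nonempty x : x0 <= x < x0 + w%:Z -> exists y, inside x y.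
Proof.
move=> xb; apply: contrapT => none.
have out y : inside x y = false by apply/negP => ?; apply: none; exists y.
have noH i : H x i = false by rewrite -inside_hstep !out.
have [|c [cH cV]] := ld_connected ld (phiH := fun k _ => k < x) (phiV := fun j _ => j <= x).
  move=> k i k' i' kk _ Hk _; case: kk Hk => -> Hk; first by lia.
  by have : k != x; [apply/eqP => E; rewrite E noH in Hk | lia].
have [k /cV] := ld_left ld; have [k' /cV] := ld_right ld; lia.
Qed.

(** The boundary of an isolated cell is closed, hence the whole loop, which is
    too wide for that. *)
Lemma no_isolated_cell x y : (3 <= w)%N -> inside x y ->
  [|| inside (x + 1) y, inside x (y + 1), inside (x - 1) y | inside x (y - 1)].
Proof.
move=> w3 ins; apply/negPn/negP; rewrite !negb_or => /and4P[nr nu nl nd].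
have Vl : V x y by rewrite -inside_vstep ins (negbTE nl).
have Vr : V (x + 1) y by apply: inside_neq_v; rewrite ins (negbTE nr).
have Hb : H x y by rewrite -inside_hstep ins (negbTE nd).
have Ht : H x (y + 1) by apply: inside_neq_h; rewrite ins (negbTE nu).
have hx1 : H (x - 1) y = false by have := ld_hexcl x y; rewrite Hb andbT => /negbTE.
have hx2 : H (x - 1) (y + 1) = false by have := ld_hexcl x (y + 1); rewrite Ht andbT => /negbTE.
have hx3 : H (x + 1) y = false by have := ld_hexcl (x + 1) y; rewrite addrK Hb => /negbTE.
have hx4 : H (x + 1) (y + 1) = false by have := ld_hexcl (x + 1) (y + 1); rewrite addrK Ht => /negbTE.
have vx1 : V x (y - 1) = false by have := ld_vexcl x y; rewrite Vl andbT => /negbTE.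
have vx2 : V (x + 1) (y - 1) = false by have := ld_vexcl (x + 1) y; rewrite Vr andbT => /negbTE.
have vx3 : V x (y + 1) = false by have := ld_vexcl x (y + 1); rewrite addrK Vl => /negbTE.
have vx4 : V (x + 1) (y + 1) = false by have := ld_vexcl (x + 1) (y + 1); rewrite addrK Vr => /negbTE.
have [|c [cH cV]] := ld_connected ld
  (phiH := fun k i => (k == x) && ((i == y) || (i == y + 1)))
  (phiV := fun j k => (k == y) && ((j == x) || (j == x + 1))).
  (* both sides say that the shared vertex is a corner of the cell *)
  move=> k i k' i' kk ii Hk Vk.
  have cornerH : (i == y) || (i == y + 1) -> (k' == x) = (k == x) || (k == x + 1).
    move=> iy; apply/idP/idP => [/eqP E|kx]; first by clear -kk E; lia.
    apply/negPn/negP => nx; have {}nx : k' = x - 1 \/ k' = x + 1 by clear -kk kx nx; lia.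
    by case/orP: iy Hk => /eqP ->; case: nx => ->; rewrite ?hx1 ?hx2 ?hx3 ?hx4.
  have cornerV : (k == x) || (k == x + 1) -> (i' == y) = (i == y) || (i == y + 1).
    move=> kx; apply/idP/idP => [/eqP E|iy]; first by clear -ii E; lia.
    apply/negPn/negP => ny; have {}ny : i' = y - 1 \/ i' = y + 1 by clear -ii iy ny; lia.
    by case/orP: kx Vk => /eqP ->; case: ny => ->; rewrite ?vx1 ?vx2 ?vx3 ?vx4.
  have [iy|niy] := boolP ((i == y) || (i == y + 1)); have [kx|nkx] := boolP ((k == x) || (k == x + 1)).
  - by rewrite cornerH // cornerV // kx iy.
  - by rewrite cornerH // (negbTE nkx) andbF.
  - by rewrite cornerV // (negbTE niy) andbF.
  - by rewrite !andbF.
have := cV _ _ Vl; rewrite !eqxx /= => E; rewrite -E in cV.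
have [k /cV /andP[_ kx]] := ld_left ld; have [k' /cV /andP[_ kx']] := ld_right ld.
by clear -kx kx' w3; lia.
Qed.

Lemma oddz_nat (n : nat) : oddz n%:Z = odd n.
Proof. by []. Qed.

End Inside.

(** Counting horizontal stitches below a cell gives the same parity. *)
Lemma inside_transpose x0 y0 w h e f H V : loop_data x0 y0 w h e f H V ->
  forall x y, inside y0 (fun i k => H k i) y x = inside x0 V x y.
Proof.
move=> ld x y; have ldT := loop_data_transpose ld.
have [xlt|xge] := ltP x x0.
  rewrite [RHS]inside_left //; apply: (inside_below ldT) => //.
have [n ->] : exists n : nat, x = x0 - 1 + n%:Z by exists (absz (x - x0 + 1)); lia.
elim: n => [|n IH].
  by rewrite [RHS]inside_left ?(inside_below ldT) //; lia.
have := inside_vstep ld (x0 - 1 + n.+1%:Z) y.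
have := inside_hstep ldT y (x0 - 1 + n.+1%:Z).
have -> : x0 - 1 + n.+1%:Z - 1 = x0 - 1 + n%:Z by lia.
by rewrite IH => <-; do 3!case: (inside _ _).
Qed.

Lemma row_nonempty x0 y0 w h e f H V : loop_data x0 y0 w h e f H V ->
  forall y, y0 <= y < y0 + h%:Z -> exists x, inside x0 V x y.
Proof.
move=> ld y /(column_nonempty (loop_data_transpose ld))[x].
by rewrite (inside_transpose ld) => ins; exists x.
Qed.

Theorem loop_data_config x0 y0 w h e f H V : loop_data x0 y0 w h e f H V -> (3 <= w)%N ->
  exists a b,
  [/\ config w h a (fun j => line_type b f (x0 + j%:Z)) (fun i => line_type b e (y0 + i%:Z))
        (window x0 y0 V),
     b = a (+) (oddz x0 (+) oddz y0),
     line_type b f x0, line_type b e y0 &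
     ~~ line_type b f (x0 + w%:Z) /\ ~~ line_type b e (y0 + h%:Z)].
Proof.
move=> ld w3; have [b [bH bV]] := inner_side ld.
have innerE x y : inner (b (+) (oddz x0 (+) oddz y0)) x y = innerz b (x0 + x%:Z) (y0 + y%:Z).
  rewrite /inner /innerz !oddzD !oddz_nat oddD.
  by case: (oddz x0); case: (oddz y0); case: (odd x); case: (odd y); case: b {bH bV}.
have lineV x y : V x y -> line_type b f x = innerz b x y.
  by move=> /(ld_vlabel ld); rewrite /line_type /innerz => ->.
have lineH x y : H x y -> line_type b e y = innerz b x y.
  by move=> /(ld_hlabel ld); rewrite /line_type /innerz addbC => ->.
have next (z : int) (n : nat) : z + n.+1%:Z = z + n%:Z + 1 by lia.
exists (b (+) (oddz x0 (+) oddz y0)), b; split; last 1 first.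
- split.
    have [k Vk] := ld_right ld; rewrite (lineV _ _ Vk) -(bV _ _ Vk).
    by rewrite (inside_right ld).
  have [k Hk] := ld_top ld; rewrite (lineH _ _ Hk) -(bH _ _ Hk).
  by rewrite (inside_above ld).
- split.
  + move=> x y /(inside_box ld); lia.
  + move=> x xw; have [|y ins] := column_nonempty ld (x := x0 + x%:Z); first by lia.
    have [_ yb] := inside_box ld ins; exists (absz (y - y0)); rewrite /window.
    by have -> : y0 + (absz (y - y0)%R)%:Z = y by lia.
  + move=> y yh; have [|x ins] := row_nonempty ld (y := y0 + y%:Z); first by lia.
    have [xb _] := inside_box ld ins; exists (absz (x - x0)); rewrite /window.
    by have -> : x0 + (absz (x - x0)%R)%:Z = x by lia.
  + move=> y; rewrite /window innerE addr0 => ins; rewrite -bV // -(inside_vstep ld).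
    by rewrite ins (@inside_left _ _ (_ - 1)) //; lia.
  + move=> x; rewrite /window innerE addr0 => ins; rewrite -bH // -(inside_hstep ld).
    by rewrite ins (inside_below ld) //; lia.
  + move=> x y; rewrite /window innerE next => uE; apply/eqP/negPn/negP => /(inside_neq_v ld) Vxy.
    move: uE; rewrite (lineV _ _ Vxy) innerz_right.
    by case: innerz.
  + move=> x y; rewrite /window innerE next => neq.
    have Vxy := inside_neq_v ld neq; have := bV _ _ Vxy.
    by rewrite innerz_right; move: neq; do 2!case: (inside _ _); case: innerz.
  + move=> x y; rewrite /window innerE next => uE; apply/eqP/negPn/negP => /(inside_neq_h ld) Vxy.
    move: uE; rewrite (lineH _ _ Vxy) innerz_up.
    by case: innerz.
  + move=> x y; rewrite /window innerE next => neq.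
    have Hxy := inside_neq_h ld neq; have := bH _ _ Hxy.
    by rewrite innerz_up; move: neq; do 2!case: (inside _ _); case: innerz.
- by case: b {bH bV innerE lineV lineH}; case: oddz; case: oddz.
- have [k Vk] := ld_left ld; rewrite (lineV _ _ Vk) -(bV _ _ Vk).
  by have := inside_vstep ld x0 k; rewrite Vk (@inside_left _ _ (_ - 1)) ?addbF //; lia.
have [k Hk] := ld_bottom ld; rewrite (lineH _ _ Hk) -(bH _ _ Hk).
by have := inside_hstep ld k y0; rewrite Hk (@inside_below _ _ _ _ _ _ _ _ ld _ (y0 - 1)) ?addbF //; lia.
Qed.

Lemma window_no_isolated x0 y0 w h e f H V : loop_data x0 y0 w h e f H V -> (3 <= w)%N ->
  let S := window x0 y0 V in forall x y, S x y ->
    [|| S x.+1 y, S x y.+1, (0 < x)%N && S x.-1 y | (0 < y)%N && S x y.-1].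
Proof.
move=> ld w3 S x y; rewrite /S /window => ins.
have := no_isolated_cell ld w3 ins.
have -> : x0 + x.+1%:Z = x0 + x%:Z + 1 by lia.
have -> : y0 + y.+1%:Z = y0 + y%:Z + 1 by lia.
case/or4P => [->|->|ins'|ins']; rewrite ?orbT //.
  have [x'b _] := inside_box ld ins'.
  have -> /= : (0 < x)%N by lia.
  have -> : x0 + x.-1%:Z = x0 + x%:Z - 1 by lia.
  by rewrite ins' !orbT.
have [_ y'b] := inside_box ld ins'.
have -> /= : (0 < y)%N by lia.
have -> : y0 + y.-1%:Z = y0 + y%:Z - 1 by lia.
by rewrite ins' !orbT.
Qed.

(** * Hitomezashi patterns and their stitches *)

(** Labels as booleans: the parities of the lower ends of the stitches. *)
Definition labelled (e f : int -> bool) (P : set stitch) : Prop :=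
  (forall k i, P (HStitch k i) <-> oddz k = e i) /\
  (forall j k, P (VStitch j k) <-> oddz k = f j).

(** Exactly one of the two stitches of a line at a vertex is in the pattern, so
    the stitches of a line alternate. *)
Lemma horizontal_at (P : set stitch) k i : hitomezashi P ->
  P (HStitch (k - 1) i) <-> ~ P (HStitch k i).
Proof.
move=> /(_ (k, i))[[s [[Ps [hs es]] uniq]] _].
have [Hs|Hs] : s = HStitch k i \/ s = HStitch (k - 1) i.
  case: s Ps hs es uniq => [k' i'|//] /= _ _ [] [-> ->] _; first by left.
  by right; rewrite addrK.
- rewrite -Hs; split=> // P1 _.
  have : s = HStitch (k - 1) i by apply: uniq; split=> //; split=> //=; right; rewrite subrK.
  by rewrite Hs => -[]; lia.
- rewrite -Hs; split=> // _ P1.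
  have : s = HStitch k i by apply: uniq; split=> //; split=> //=; left.
  by rewrite Hs => -[]; lia.
Qed.

Lemma vertical_at (P : set stitch) j k : hitomezashi P ->
  P (VStitch j (k - 1)) <-> ~ P (VStitch j k).
Proof.
move=> /(_ (j, k))[_ [s [[Ps [hs es]] uniq]]].
have [Hs|Hs] : s = VStitch j k \/ s = VStitch j (k - 1).
  case: s Ps hs es uniq => [//|j' k'] /= _ _ [] [-> ->] _; first by left.
  by right; rewrite addrK.
- rewrite -Hs; split=> // P1 _.
  have : s = VStitch j (k - 1) by apply: uniq; split=> //; split=> //=; right; rewrite subrK.
  by rewrite Hs => -[]; lia.
- rewrite -Hs; split=> // _ P1.
  have : s = VStitch j k by apply: uniq; split=> //; split=> //=; left.
  by rewrite Hs => -[]; lia.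
Qed.

Lemma alternating (p : int -> Prop) : (forall k, p (k - 1) <-> ~ p k) ->
  exists b, forall k, p k <-> oddz k = b.
Proof.
move=> alt; pose q k := `[< p k >].
have altq k : q (k - 1) = ~~ q k by rewrite /q -asbool_neg; apply: asbool_equiv_eq.
have even_case (n : nat) : q n%:Z = oddz n%:Z (+) q 0 /\ q (- n%:Z) = oddz (- n%:Z) (+) q 0.
  elim: n => [//|n [IH1 IH2]]; split.
    have := altq n.+1%:Z; have -> : n.+1%:Z - 1 = n%:Z by lia.
    by rewrite IH1 /oddz /=; case: (odd n); case: (q 0); case: (q n.+1).
  have := altq (- n%:Z); have -> : - n%:Z - 1 = - n.+1%:Z by lia.
  by rewrite IH2 /oddz !abszN /= => ->; case: (odd n); case: (q 0).
have qE k : q k = oddz k (+) q 0.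
  have [n [|] ->] : exists n : nat, k = n%:Z \/ k = - n%:Z by exists (absz k); lia.
    by case: (even_case n).
  by case: (even_case n).
exists (~~ q 0) => k; split=> [pk|o].
  by have : q k by [apply/asboolP]; rewrite qE; case: oddz; case: (q 0).
by apply/asboolP; rewrite -/(q k) qE o; case: (q 0).
Qed.

Lemma hitomezashi_labelled (P : set stitch) : hitomezashi P -> exists e f, labelled e f P.
Proof.
move=> hP.
have [e eP] := choice (fun i => alternating (p := fun k => P (HStitch k i)) (fun k => horizontal_at k i hP)).
have [f fP] := choice (fun j => alternating (p := fun k => P (VStitch j k)) (fun k => vertical_at j k hP)).
by exists e, f; split=> *; [apply: eP | apply: fP].
Qed.

Lemma intr_Z2 (k : int) : k%:~R = (oddz k)%:R :> 'Z_2.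
Proof.
have nat_case (n : nat) : n%:R = (odd n)%:R :> 'Z_2.
  elim: n => [//|n IH]; rewrite mulrSr IH /=.
  by case: (odd n) => //=; apply: val_inj.
case: k => n; first exact: nat_case.
rewrite NegzE mulrNz; have -> : n.+1%:~R = n.+1%:R :> 'Z_2 by [].
by rewrite nat_case /oddz abszN /=; case: (odd n) => //=; apply: val_inj.
Qed.

Lemma Z2_bool (b c : bool) : (b%:R = c%:R :> 'Z_2) <-> b = c.
Proof. by split=> [|->//]; case: b; case: c. Qed.

Lemma Z2_eq1 (z : 'Z_2) : z = (z == 1)%:R.
Proof. by case: z => -[|[|//]] i; apply: val_inj. Qed.

Lemma labelled_label_pattern e f P : labelled e f P ->
  P = label_pattern (fun i => (e i)%:R) (fun j => (f j)%:R).
Proof.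
move=> [He Hf]; apply/seteqP; split=> -[k i|j k] /=;
  by rewrite intr_Z2 Z2_bool => H; first [apply/He | apply/Hf].
Qed.

Lemma label_pattern_labelled eps eta :
  labelled (fun i => eps i == 1) (fun j => eta j == 1) (label_pattern eps eta).
Proof.
split=> k i /=; rewrite intr_Z2.
  by have := Z2_bool (oddz k) (eps i == 1); rewrite -(Z2_eq1 (eps i)).
by have := Z2_bool (oddz i) (eta k == 1); rewrite -(Z2_eq1 (eta k)).
Qed.

Section Segments.
Variable R : realType.
Implicit Types (s t : stitch) (x : R * R).

Lemma int_lt_half (m n : int) : m%:~R <= n%:~R + 2^-1 :> R -> m <= n.
Proof.
move=> le_mn; suff : m < n + 1 by lia.
by rewrite -(ltr_int R) intrD; lra.
Qed.

Lemma int_half_lt (m n : int) : n%:~R + 2^-1 <= (m + 1)%:~R :> R -> n <= m.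
Proof.
move=> le_nm; suff : n < m + 1 by lia.
by rewrite -(ltr_int R); lra.
Qed.

Lemma int_neq_half (m n : int) : m%:~R <> n%:~R + 2^-1 :> R.
Proof.
move=> E; have mn : m <= n by apply: int_lt_half; rewrite E.
have nm : n <= m - 1 by apply: int_half_lt; rewrite subrK E.
lia.
Qed.

(** The midpoint of a stitch determines it, because one coordinate is an
    integer and the other is not. *)
Lemma midpoint_in s t : segment s (midpoint R t) -> s = t.
Proof.
case: s => k i; case: t => k' i' /= [].
- move=> /andP[/int_lt_half a /int_half_lt b] /intr_inj ->.
  by congr HStitch; lia.
- by move=> _ /esym /int_neq_half.
- by move=> /esym /int_neq_half.
- move=> /intr_inj -> /andP[/int_lt_half a /int_half_lt b].
  by congr VStitch; lia.
Qed.

Lemma midpoint_segment s : segment s (midpoint R s).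
Proof. by case: s => k i /=; split=> //; rewrite intrD; lra. Qed.

(** Distinct stitches only meet at their ends. *)
Lemma segment_meet s t x : segment s x -> segment t x ->
  s = t \/ exists v, endpoint s v /\ endpoint t v.
Proof.
case: s => k i; case: t => k' i' /= [].
- move=> /andP[a b] -> [/andP[c d] /intr_inj ->].
  have l1 : k <= k' + 1 by rewrite -(ler_int R); apply: le_trans a d.
  have l2 : k' <= k + 1 by rewrite -(ler_int R); apply: le_trans c b.
  have [->|[->|->]] : k' = k \/ k' = k + 1 \/ k' = k - 1 by lia.
  + by left.
  + by right; exists (k + 1, i'); split; [right|left].
  + by right; exists (k, i'); split; [left|right; rewrite subrK].
- move=> /andP[a b] E [E' /andP[c d]]; rewrite E' !ler_int in a b; rewrite E !ler_int in c d.
  by right; exists (k', i); split; [have [->|->] : k' = k \/ k' = k + 1 by lia|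
    have [->|->] : i = i' \/ i = i' + 1 by lia]; by [left|right].
- move=> E /andP[a b] [/andP[c d] E']; rewrite E' !ler_int in a b; rewrite E !ler_int in c d.
  by right; exists (k, i'); split; [have [->|->] : i' = i \/ i' = i + 1 by lia|
    have [->|->] : k = k' \/ k = k' + 1 by lia]; by [left|right].
- move=> -> /andP[a b] [/intr_inj -> /andP[c d]].
  have l1 : i <= i' + 1 by rewrite -(ler_int R); apply: le_trans a d.
  have l2 : i' <= i + 1 by rewrite -(ler_int R); apply: le_trans c b.
  have [->|[->|->]] : i' = i \/ i' = i + 1 \/ i' = i - 1 by lia.
  + by left.
  + by right; exists (k', i + 1); split; [right|left].
  + by right; exists (k', i); split; [left|right; rewrite subrK].
Qed.

Lemma endpoint_segment s v : endpoint s v -> segment s (v.1%:~R, v.2%:~R : R).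
Proof.
by case: s => k i /= [] -> /=; rewrite !intrD; split=> //; lra.
Qed.

Lemma connected_hor (a b c : R) : connected [set p : R * R | a <= p.1 <= b /\ p.2 = c].
Proof.
rewrite (_ : [set p | _] = (fun r => (r, c)) @` `[a, b]).
  apply: connected_continuous_connected; first exact: segment_connected.
  apply: continuous_subspaceT => r.
  exact: (cvg_pair (F := nbhs r) (@cvg_id _ _) (cvg_cst c)).
apply/seteqP; split=> [[p1 p2] /= [ab ->]|_ [r /= rab <-]] /=.
  by exists p1 => //; rewrite /= in_itv.
by rewrite in_itv in rab.
Qed.

Lemma connected_ver (a b c : R) : connected [set p : R * R | p.1 = c /\ a <= p.2 <= b].
Proof.
rewrite (_ : [set p | _] = (fun r => (c, r)) @` `[a, b]).
  apply: connected_continuous_connected; first exact: segment_connected.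
  apply: continuous_subspaceT => r.
  exact: (cvg_pair (F := nbhs r) (cvg_cst c) (@cvg_id _ _)).
apply/seteqP; split=> [[p1 p2] /= [-> ab]|_ [r /= rab <-]] /=.
  by exists p2 => //; rewrite /= in_itv.
by rewrite in_itv in rab.
Qed.

Lemma connected_stitch s : connected (segment s : set (R * R)).
Proof. by case: s => k i; [exact: connected_hor | exact: connected_ver]. Qed.

Lemma closed_box (a b c d : R) : closed [set p : R * R | a <= p.1 <= b /\ c <= p.2 <= d].
Proof.
rewrite (_ : [set p | _] = `[a, b] `*` `[c, d]); last first.
  by apply/seteqP; split=> -[p1 p2] /=; rewrite !in_itv.
apply: compact_closed; first exact: norm_hausdorff.
by apply: compact_setX; exact: segment_compact.
Qed.

Lemma closed_stitch s : closed (segment s : set (R * R)).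
Proof.
case: s => k i.
  rewrite (_ : segment _ = [set p : R * R | k%:~R <= p.1 <= (k + 1)%:~R /\ i%:~R <= p.2 <= i%:~R]).
    exact: closed_box.
  apply/seteqP; split=> -[p1 p2] /= [ab]; first by move=> ->; rewrite lexx.
  by rewrite -eq_le => /eqP ->.
rewrite (_ : segment _ = [set p : R * R | k%:~R <= p.1 <= k%:~R /\ i%:~R <= p.2 <= (i + 1)%:~R]).
  exact: closed_box.
apply/seteqP; split=> -[p1 p2] /= []; first by move=> -> ?; rewrite lexx.
by rewrite -eq_le => /eqP ->.
Qed.

Lemma bounded_coords (A : set (R * R)) :
  bounded_set A <-> exists M : R, forall p, A p -> - M <= p.1 <= M /\ - M <= p.2 <= M.
Proof.
split.
  move=> /pinfty_ex_gt0[M _ AM]; exists M => p Ap.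
  have := AM p Ap; rewrite /= prod_normE ge_max => /andP[]; rewrite !ler_norml => -> ->.
  by [].
move=> [M AM]; exists M; split; first exact: num_real.
move=> y My p Ap; have [a b] := AM p Ap.
rewrite /= prod_normE ge_max !ler_norml; lra.
Qed.

End Segments.

(** * From a loop to its stitches *)

Section Loop.
Variables (R : realType) (e f : int -> bool) (P : set stitch) (L : set (R * R)).
Hypotheses (Plab : labelled e f P) (loopL : loop_of P L).
Local Notation inL := (stitches_in L).

Lemma labelled_hor k i : P (HStitch (k - 1) i) <-> ~ P (HStitch k i).
Proof. by rewrite !Plab.1 oddz_pred; case: oddz; case: (e i). Qed.

Lemma labelled_ver j k : P (VStitch j (k - 1)) <-> ~ P (VStitch j k).
Proof. by rewrite !Plab.2 oddz_pred; case: oddz; case: (f j). Qed.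

Lemma loop_connected : connected L.
Proof. by case: loopL => p [_ -> _]; exact: component_connected. Qed.

Lemma loop_bounded : bounded_set L.
Proof. by case: loopL => p []. Qed.

Lemma loop_sub : L `<=` stitch_union P.
Proof. by case: loopL => p [_ -> _]; exact: connected_component_sub. Qed.

Lemma loop_nonempty : exists s, inL s.
Proof.
suff [x Lx] : exists x, L x.
  have [s Ps sx] := loop_sub Lx; exists s.
  move=> y sy; case: loopL Lx => p [_ -> _] px.
  apply: (connected_component_trans px).
  apply: (connected_component_max (B := segment s)) sy => //; last exact: connected_stitch.
  by move=> z sz; exists s.
by case: loopL => p [Pp -> _]; exists p; exact: connected_component_refl.
Qed.

Lemma stitch_in_loop s x : P s -> segment s x -> L x -> inL s.
Proof.
move=> Ps sx; case: loopL => p [_ -> _] px y sy.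
apply: (connected_component_trans px).
apply: (connected_component_max (B := segment s)) sy => //; last exact: connected_stitch.
by move=> z sz; exists s.
Qed.

Lemma loop_cover x : L x -> exists2 s, inL s & segment s x.
Proof. by move=> Lx; have [s Ps sx] := loop_sub Lx; exists s => //; apply: stitch_in_loop sx Lx. Qed.

(** A unit segment contained in the loop is one of its stitches, since a
    stitch that contains its midpoint is equal to it. *)
Lemma in_loop_pattern s : inL s -> P s.
Proof.
move=> /(_ _ (midpoint_segment R s)) /loop_sub [t Pt].
by move=> /midpoint_in <-.
Qed.

Lemma finite_int_box (M : R) : finite_set [set k : int | - M <= k%:~R <= M].
Proof.
have [N MN] : exists N : nat, M < N%:R.
  exists (Num.bound `|M|); apply: le_lt_trans (ler_norm _) _.
  by have := archi_boundP (normr_ge0 M).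
apply: (@sub_finite_set _ _ ((fun n : nat => n%:Z - N%:Z) @` `I_(2 * N).+1)).
  move=> k /= /andP[k1 k2].
  have l1 : k < N%:Z by rewrite -(ltr_int R) (le_lt_trans k2).
  have l2 : - N%:Z < k by rewrite -(ltr_int R) intrN; apply: lt_le_trans k1; rewrite ltrN2.
  by exists (absz (k + N%:Z)); rewrite /=; lia.
exact/finite_image/finite_II.
Qed.

(** A bounded set meets finitely many stitches. *)
Lemma closed_stitches (Q : set stitch) : Q `<=` inL -> closed (stitch_union Q : set (R * R)).
Proof.
move=> QL; have [M LM] := (bounded_coords L).1 loop_bounded.
have bnd s v : inL s -> endpoint s v -> - M <= v.1%:~R <= M /\ - M <= v.2%:~R <= M.
  by move=> sL /(endpoint_segment R) /sL /LM.
have fin : finite_set ([set k : int | - M <= k%:~R <= M] `*` [set k : int | - M <= k%:~R <= M]).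
  by apply: finite_setX; exact: finite_int_box.
pose QH := [set v : int * int | Q (HStitch v.1 v.2)].
pose QV := [set v : int * int | Q (VStitch v.1 v.2)].
have finH : finite_set QH.
  by apply: sub_finite_set fin => -[k i] /= /QL sL; apply: (bnd _ (k, i) sL); left.
have finV : finite_set QV.
  by apply: sub_finite_set fin => -[k i] /= /QL sL; apply: (bnd _ (k, i) sL); left.
rewrite (_ : stitch_union Q = \bigcup_(v in QH) segment (HStitch v.1 v.2) `|`
    \bigcup_(v in QV) segment (VStitch v.1 v.2)).
  by apply: closedU; apply: closed_bigcup => // v _; exact: closed_stitch.
apply/seteqP; split=> [x [[k i|j k] Qs sx]|x [] [v Qv sx]].
- by left; exists (k, i).
- by right; exists (j, k).
- by exists (HStitch v.1 v.2).
- by exists (VStitch v.1 v.2).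
Qed.

(** A set of stitches of the loop that is stable under passing to a stitch
    with a common end covers a subset of the loop that is closed, as is the
    complementary union of stitches; these are disjoint, so one is empty because
    the loop is connected. *)
Lemma loop_minimal (Q : set stitch) :
  (exists2 s, inL s & Q s) ->
  (forall s t, inL s -> inL t -> Q s -> (exists v, endpoint s v /\ endpoint t v) -> Q t) ->
  forall t, inL t -> Q t.
Proof.
move=> [s0 s0L Qs0] adj t tL; apply: contrapT => nQt.
pose A := stitch_union (inL `&` Q) : set (R * R).
pose B := stitch_union (inL `&` ~` Q) : set (R * R).
have clA : closed A by apply: closed_stitches => s [].
have clB : closed B by apply: closed_stitches => s [].
have AL : A `<=` L by move=> x [s [sL _] sx]; apply: sL.
have dis x : A x -> ~ B x.
  move=> [s [sL Qs] sx] [t' [tL' nQt'] tx]; apply: nQt'.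
  by have [<-//|] := segment_meet sx tx; apply: adj.
have AE : A = L.
  apply: loop_connected.
  - exists (midpoint R s0), s0; [by split|exact: midpoint_segment].
  - exists (~` B); first exact: closed_openC.
    apply/seteqP; split=> x; first by move=> Ax; split; [exact: AL|exact: dis].
    move=> [/loop_cover[s sL sx] nB]; exists s => //; split=> //.
    by apply: contrapT => nQ; apply: nB; exists s.
  - by exists A => //; rewrite setIC; apply/esym/setIidPl.
have : A (midpoint R t) by rewrite AE; apply/tL/midpoint_segment.
by move=> [s [_ Qs] /midpoint_in E]; rewrite E in Qs.
Qed.

Definition hstitch_in k i : bool := `[< inL (HStitch k i) >].
Definition vstitch_in j k : bool := `[< inL (VStitch j k) >].

Lemma vertical_in_at k i : L (k%:~R, i%:~R) -> vstitch_in k (i - 1) || vstitch_in k i.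
Proof.
move=> Lv; have [Pv|] := pselect (P (VStitch k i)).
  apply/orP; right; apply/asboolP; apply: (stitch_in_loop Pv _ Lv).
  by apply: (endpoint_segment R (v := (k, i))); left.
move=> /labelled_ver Pv; apply/orP; left; apply/asboolP; apply: (stitch_in_loop Pv _ Lv).
by apply: (endpoint_segment R (v := (k, i))); right; rewrite subrK.
Qed.

Lemma horizontal_in_at k i : L (k%:~R, i%:~R) -> hstitch_in (k - 1) i || hstitch_in k i.
Proof.
move=> Lv; have [Pv|] := pselect (P (HStitch k i)).
  apply/orP; right; apply/asboolP; apply: (stitch_in_loop Pv _ Lv).
  by apply: (endpoint_segment R (v := (k, i))); left.
move=> /labelled_hor Pv; apply/orP; left; apply/asboolP; apply: (stitch_in_loop Pv _ Lv).
by apply: (endpoint_segment R (v := (k, i))); right; rewrite subrK.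
Qed.

Lemma endpoint_in_loop s k i : inL s -> endpoint s (k, i) -> L (k%:~R, i%:~R).
Proof. by move=> sL /(endpoint_segment R) /sL. Qed.

Lemma loop_vertex k i : hstitch_in (k - 1) i || hstitch_in k i = vstitch_in k (i - 1) || vstitch_in k i.
Proof.
apply/idP/idP => /orP[] /asboolP sL; first [apply: vertical_in_at | apply: horizontal_in_at];
  by apply: (endpoint_in_loop sL); rewrite /= ?subrK; auto.
Qed.

(** Two horizontal stitches of a pattern have no common end, so only the
    meetings of a horizontal and a vertical stitch matter. *)
Lemma loop_two_coloring (phiH phiV : int -> int -> bool) :
  (forall k i k' i', k' = k - 1 \/ k' = k -> i' = i - 1 \/ i' = i ->
     hstitch_in k' i -> vstitch_in k i' -> phiH k' i = phiV k i') ->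
  exists c, (forall k i, hstitch_in k i -> phiH k i = c) /\
            (forall j k, vstitch_in j k -> phiV j k = c).
Proof.
move=> adj; pose phi s := match s with HStitch k i => phiH k i | VStitch j k => phiV j k end.
have [s0 s0L] := loop_nonempty.
have HV k i j l : inL (HStitch k i) -> inL (VStitch j l) ->
    (exists v, endpoint (HStitch k i) v /\ endpoint (VStitch j l) v) -> phiH k i = phiV j l.
  move=> hL vL [[a b] /= [Hh Hv]].
  have [ka ib] : (k = a - 1 \/ k = a) /\ i = b.
    by case: Hh => -[-> ->]; split=> //; [right|left; rewrite addrK].
  have [lb ja] : (l = b - 1 \/ l = b) /\ j = a.
    by case: Hv => -[-> ->]; split=> //; [right|left; rewrite addrK].
  by rewrite ja ib; apply: adj => //; rewrite -?ib -?ja; apply/asboolP.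
have same s t : inL s -> inL t -> phi s = phi s0 ->
    (exists v, endpoint s v /\ endpoint t v) -> phi t = phi s0.
  move=> sL tL <-; case: s t sL tL => k i [] k' i' sL tL.
  - move=> [v /= [Hs Ht]]; suff [-> ->] : k' = k /\ i' = i by [].
    have [ii kk] : i' = i /\ (k' = k \/ k' = k + 1 \/ k = k' + 1).
      by case: Hs Ht => -> [] [] a b; split; clear -a b; lia.
    have := in_loop_pattern sL; have := in_loop_pattern tL; rewrite !Plab.1 ii.
    by case: kk => [->//|[->|->]]; rewrite oddzS => <-; case: oddz.
  - by move=> E; rewrite /= (HV k i k' i').
  - by move=> [v [E1 E2]]; rewrite /= (HV k' i' k i) //; exists v.
  - move=> [v /= [Hs Ht]]; suff [-> ->] : k' = k /\ i' = i by [].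
    have [kk ii] : k' = k /\ (i' = i \/ i' = i + 1 \/ i = i' + 1).
      by case: Hs Ht => -> [] [] a b; split; clear -a b; lia.
    have := in_loop_pattern sL; have := in_loop_pattern tL; rewrite !Plab.2 kk.
    by case: ii => [->//|[->|->]]; rewrite oddzS => <-; case: oddz.
have all := loop_minimal (Q := [set s | phi s = phi s0]) (ex_intro2 _ _ s0 s0L erefl) same.
by exists (phi s0); split=> k i /asboolP /all.
Qed.

Lemma hstitch_ends k i : inL (HStitch k i) ->
  (exists l, inL (VStitch k l)) /\ (exists l, inL (VStitch (k + 1) l)).
Proof.
move=> sL; split.
  have /vertical_in_at/orP[] : L (k%:~R, i%:~R) by apply: (endpoint_in_loop sL); left.
    by move/asboolP; exists (i - 1).
  by move/asboolP; exists i.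
have /vertical_in_at/orP[] : L ((k + 1)%:~R, i%:~R) by apply: (endpoint_in_loop sL); right.
  by move/asboolP; exists (i - 1).
by move/asboolP; exists i.
Qed.

Lemma vstitch_ends j k : inL (VStitch j k) ->
  (exists l, inL (HStitch l k)) /\ (exists l, inL (HStitch l (k + 1))).
Proof.
move=> sL; split.
  have /horizontal_in_at/orP[] : L (j%:~R, k%:~R) by apply: (endpoint_in_loop sL); left.
    by move/asboolP; exists (j - 1).
  by move/asboolP; exists j.
have /horizontal_in_at/orP[] : L (j%:~R, (k + 1)%:~R) by apply: (endpoint_in_loop sL); right.
  by move/asboolP; exists (j - 1).
by move/asboolP; exists j.
Qed.

(** The stitches of extremal longitude are vertical: a horizontal stitch has
    vertical stitches at its two ends, half a unit further out on either
    side. *)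
Lemma loop_width (w : nat) : has_width L w%:R -> exists x0 : int,
  [/\ exists k, inL (VStitch x0 k), exists k, inL (VStitch (x0 + w%:Z) k),
      forall j k, inL (VStitch j k) -> x0 <= j <= x0 + w%:Z &
      forall k i, inL (HStitch k i) -> x0 <= k < x0 + w%:Z].
Proof.
move=> [[s sL [t tL E]] ub].
have {ub}ub s' t' : inL s' -> inL t' -> longitude R s' - longitude R t' <= longitude R s - longitude R t.
  by move=> s'L t'L; rewrite E; apply: ub; exists s' => //; exists t'.
have half : (0 < 2^-1 :> R) by rewrite invr_gt0 ltr0n.
case: s sL E ub => k i sL E ub.
  have [_ [l vL]] := hstitch_ends sL; have := ub _ _ vL tL.
  by rewrite /longitude /= intrD; lra.
case: t tL E ub => x0 l tL E ub.
  have [[l' vL] _] := hstitch_ends tL; have := ub _ _ sL vL.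
  by rewrite /longitude /=; lra.
have Ek : k = x0 + w%:Z.
  apply/eqP; rewrite -(eqr_int R) intrD; apply/eqP.
  by move: E; rewrite /longitude /= => E; have : (w%:Z)%:~R = w%:R :> R by []; lra.
have vbox j m : inL (VStitch j m) -> x0 <= j <= x0 + w%:Z.
  move=> jL; apply/andP; split; rewrite -(ler_int R).
    by have := ub _ _ sL jL; rewrite /longitude /=; lra.
  by have := ub _ _ jL tL; rewrite /longitude /= -Ek; lra.
exists x0; split=> //; first by exists l.
  by exists i; rewrite -Ek.
move=> k' i' /hstitch_ends [[l1 /vbox b1] [l2 /vbox b2]]; lia.
Qed.

Lemma loop_height (h : nat) : has_height L h%:R -> exists y0 : int,
  [/\ exists k, inL (HStitch k y0), exists k, inL (HStitch k (y0 + h%:Z)),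
      forall k i, inL (HStitch k i) -> y0 <= i <= y0 + h%:Z &
      forall j k, inL (VStitch j k) -> y0 <= k < y0 + h%:Z].
Proof.
move=> [[s sL [t tL E]] ub].
have {ub}ub s' t' : inL s' -> inL t' -> latitude R s' - latitude R t' <= latitude R s - latitude R t.
  by move=> s'L t'L; rewrite E; apply: ub; exists s' => //; exists t'.
have half : (0 < 2^-1 :> R) by rewrite invr_gt0 ltr0n.
case: s sL E ub => i k sL E ub; last first.
  have [_ [l vL]] := vstitch_ends sL; have := ub _ _ vL tL.
  by rewrite /latitude /= intrD; lra.
case: t tL E ub => l y0 tL E ub; last first.
  have [[l' vL] _] := vstitch_ends tL; have := ub _ _ sL vL.
  by rewrite /latitude /=; lra.
have Ek : k = y0 + h%:Z.
  apply/eqP; rewrite -(eqr_int R) intrD; apply/eqP.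
  by move: E; rewrite /latitude /= => E; have : (h%:Z)%:~R = h%:R :> R by []; lra.
have hbox m j : inL (HStitch m j) -> y0 <= j <= y0 + h%:Z.
  move=> jL; apply/andP; split; rewrite -(ler_int R).
    by have := ub _ _ sL jL; rewrite /latitude /=; lra.
  by have := ub _ _ jL tL; rewrite /latitude /= -Ek; lra.
exists y0; split=> //; first by exists l.
  by exists i; rewrite -Ek.
move=> k' i' /vstitch_ends [[l1 /hbox b1] [l2 /hbox b2]]; lia.
Qed.

Theorem loop_data_of_loop (w h : nat) : has_width L w%:R -> has_height L h%:R ->
  exists x0 y0, loop_data x0 y0 w h e f hstitch_in vstitch_in.
Proof.
move=> /loop_width[x0 [[l lL] [r rL] vx hx]] /loop_height[y0 [[b bL] [t tL] hy vy]].
exists x0, y0; split.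
- by move=> k i /asboolP /in_loop_pattern /Plab.1.
- by move=> j k /asboolP /in_loop_pattern /Plab.2.
- exact: loop_vertex.
- exact: loop_two_coloring.
- by move=> k i /asboolP s; split; [exact: hx s | exact: hy s].
- by move=> j k /asboolP s; split; [exact: vx s | exact: vy s].
- by exists l; apply/asboolP.
- by exists r; apply/asboolP.
- by exists b; apply/asboolP.
- by exists t; apply/asboolP.
Qed.

End Loop.

(** * The components of the complement of a loop *)

Lemma between_ints (R : realType) (a : R) (n m : int) : n%:~R < a < (n + 1)%:~R -> a <> m%:~R.
Proof. by move=> /andP[+ +] E; rewrite E !ltr_int; lia. Qed.

Lemma toward_half (R : realType) (a t : R) (n : int) :
  0 < t -> t <= 1 -> n%:~R <= a -> a < (n + 1)%:~R ->
  n%:~R < a + t * (n%:~R + 2^-1 - a) < (n + 1)%:~R.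
Proof.
rewrite intrD => t0 t1 l1 l2; have half : (0 < 2^-1 :> R) by rewrite invr_gt0 ltr0n.
have p1 : 0 <= (1 - t) * (a - n%:~R) by apply: mulr_ge0; lra.
have p2 : 0 <= (1 - t) * (n%:~R + 1%:~R - a) by apply: mulr_ge0; lra.
have p3 : 0 < t * 2^-1 by apply: mulr_gt0.
apply/andP; split; lra.
Qed.

Section Area.
Variables (R : realType) (e f : int -> bool) (P : set stitch) (L : set (R * R)).
Variables (x0 y0 : int) (w h : nat).
Hypothesis loopL : loop_of P L.
Local Notation H := (hstitch_in L).
Local Notation V := (vstitch_in L).
Hypothesis ld : loop_data x0 y0 w h e f H V.
Local Notation ins := (inside x0 V).

Definition cell (x y : int) : set (R * R) :=
  [set p | x%:~R <= p.1 <= (x + 1)%:~R /\ y%:~R <= p.2 <= (y + 1)%:~R].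

Definition open_cell (x y : int) : set (R * R) :=
  [set p | x%:~R < p.1 < (x + 1)%:~R /\ y%:~R < p.2 < (y + 1)%:~R].

Definition center (x y : int) : R * R := (x%:~R + 2^-1, y%:~R + 2^-1).

Lemma floor_cell (p : R * R) : cell (Num.floor p.1) (Num.floor p.2) p.
Proof. by split; apply/andP; split; rewrite ?floor_le_tmp ?ltW ?floorD1_gt. Qed.

Lemma near_cols (x x' : int) (r : R) :
  x%:~R <= r <= (x + 1)%:~R -> x'%:~R <= r <= (x' + 1)%:~R ->
  [\/ x' = x, x' = x + 1 /\ r = (x + 1)%:~R | x = x' + 1 /\ r = (x' + 1)%:~R].
Proof.
move=> /andP[a b] /andP[c d].
have l1 : x <= x' + 1 by rewrite -(ler_int R); apply: le_trans a d.
have l2 : x' <= x + 1 by rewrite -(ler_int R); apply: le_trans c b.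
have [->|[E|E]] : x' = x \/ x' = x + 1 \/ x = x' + 1 by lia.
- by constructor 1.
- by constructor 2; split=> //; apply/eqP; rewrite eq_le b -E c.
- by constructor 3; split=> //; apply/eqP; rewrite eq_le d -E a.
Qed.

Lemma loop_vstitch j k (p : R * R) : V j k -> p.1 = j%:~R -> k%:~R <= p.2 <= (k + 1)%:~R -> L p.
Proof. by move=> /asboolP sL E1 E2; apply: sL. Qed.

Lemma loop_hstitch k i (p : R * R) : H k i -> p.2 = i%:~R -> k%:~R <= p.1 <= (k + 1)%:~R -> L p.
Proof. by move=> /asboolP sL E1 E2; apply: sL. Qed.

Lemma cross_column x x' y p : cell x y p -> cell x' y p -> ins x y != ins x' y -> L p.
Proof.
move=> [px py] [px' _] neq; case: (near_cols px px') => [E|[E E']|[E E']].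
- by rewrite E eqxx in neq.
- by apply: loop_vstitch (inside_neq_v ld (x := x) (y := y) _) E' py; rewrite -E.
- by apply: loop_vstitch (inside_neq_v ld (x := x') (y := y) _) E' py; rewrite -E eq_sym.
Qed.

Lemma cross_row x y y' p : cell x y p -> cell x y' p -> ins x y != ins x y' -> L p.
Proof.
move=> [px py] [_ py'] neq; case: (near_cols py py') => [E|[E E']|[E E']].
- by rewrite E eqxx in neq.
- by apply: loop_hstitch (inside_neq_h ld (x := x) (y := y) _) E' px; rewrite -E.
- by apply: loop_hstitch (inside_neq_h ld (x := x) (y := y') _) E' px; rewrite -E eq_sym.
Qed.

(** A path between the two cells through a cell in the column of one and the
    row of the other crosses a stitch that contains [p]. *)
Lemma boundary_in_loop x y x' y' p : cell x y p -> cell x' y' p -> ins x y -> ~~ ins x' y' -> L p.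
Proof.
move=> c c' i i'; have c'' : cell x' y p by split; [case: c' | case: c].
have [i''|n''] := boolP (ins x' y).
  by apply: (cross_row c'' c'); rewrite i'' (negbTE i').
by apply: (cross_column c c''); rewrite i (negbTE n'').
Qed.

Definition in_cells : set (R * R) := [set p | exists x y, ins x y /\ cell x y p].

Definition far : set (R * R) :=
  [set p | p.1 <= x0%:~R \/ (x0 + w%:Z)%:~R <= p.1 \/ p.2 <= y0%:~R \/ (y0 + h%:Z)%:~R <= p.2].

(** The union of the cells that are not inside, written as a finite union of
    cells and half-planes so that it is visibly closed. *)
Definition out_cells : set (R * R) :=
  far `|` [set p | exists x y, [/\ ~~ ins x y, x0 <= x < x0 + w%:Z, y0 <= y < y0 + h%:Z & cell x y p]].

Lemma closed_cell x y : closed (cell x y).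
Proof. exact: closed_box. Qed.

Definition window_range : set (int * int) :=
  [set v | x0 <= v.1 < x0 + w%:Z /\ y0 <= v.2 < y0 + h%:Z].

Lemma finite_window : finite_set window_range.
Proof.
apply: (@sub_finite_set _ _ ((fun v : nat * nat => (x0 + v.1%:Z, y0 + v.2%:Z)) @` (`I_w `*` `I_h))).
  move=> [x y]; rewrite /window_range /mkset /= => -[xb yb].
  have {}xb : (x0 <= x < x0 + w%:Z)%R := xb.
  have {}yb : (y0 <= y < y0 + h%:Z)%R := yb.
  have [m xm] : exists m : nat, x = x0 + m%:Z by exists (absz (x - x0)); lia.
  have [n yn] : exists n : nat, y = y0 + n%:Z by exists (absz (y - y0)); lia.
  by exists (m, n); rewrite /= ?xm ?yn //; split; rewrite /= /mkset; lia.
by apply/finite_image/finite_setX; exact: finite_II.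
Qed.

Lemma closed_cells (Q : int -> int -> Prop) :
  closed [set p | exists x y, [/\ Q x y, x0 <= x < x0 + w%:Z, y0 <= y < y0 + h%:Z & cell x y p]].
Proof.
rewrite (_ : [set p | _] = \bigcup_(v in window_range `&` [set v | Q v.1 v.2]) cell v.1 v.2).
  apply: closed_bigcup; last by move=> v _; exact: closed_cell.
  exact/finite_setIl/finite_window.
apply/seteqP; split=> [p [x [y [Qxy xb yb c]]]|p [[x y] [[xb yb] Qxy] c]].
  by exists (x, y).
by exists x, y.
Qed.

Lemma closed_in_cells : closed in_cells.
Proof.
rewrite (_ : in_cells = [set p | exists x y, [/\ ins x y, x0 <= x < x0 + w%:Z, y0 <= y < y0 + h%:Z & cell x y p]]).
  exact: closed_cells.
apply/seteqP; split=> p [x [y]].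
  by move=> [i c]; exists x, y; have [xb yb] := inside_box ld i.
by move=> [i _ _ c]; exists x, y.
Qed.

Lemma closed_far : closed far.
Proof.
have c1 r : closed [set p : R * R | p.1 <= r].
  by apply: (@preimage_closed _ _ fst [set x | x <= r]) => // x _; exact: cvg_fst.
have c2 r : closed [set p : R * R | r <= p.1].
  by apply: (@preimage_closed _ _ fst [set x | r <= x]) => // x _; exact: cvg_fst.
have c3 r : closed [set p : R * R | p.2 <= r].
  by apply: (@preimage_closed _ _ snd [set x | x <= r]) => // x _; exact: cvg_snd.
have c4 r : closed [set p : R * R | r <= p.2].
  by apply: (@preimage_closed _ _ snd [set x | r <= x]) => // x _; exact: cvg_snd.
rewrite (_ : far = [set p | p.1 <= x0%:~R] `|` ([set p | (x0 + w%:Z)%:~R <= p.1] `|`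
  ([set p | p.2 <= y0%:~R] `|` [set p | (y0 + h%:Z)%:~R <= p.2]))) //.
by do 3!apply: closedU => //.
Qed.

Lemma closed_out_cells : closed out_cells.
Proof. by apply: closedU; [exact: closed_far | exact: closed_cells]. Qed.

Lemma in_or_out p : in_cells p \/ out_cells p.
Proof.
have c := floor_cell p.
have [i|ni] := boolP (ins (Num.floor p.1) (Num.floor p.2)); first by left; exists (Num.floor p.1), (Num.floor p.2).
right; have [F|nF] := pselect (far p); [by left | right].
exists (Num.floor p.1), (Num.floor p.2); split=> //.
- apply/andP; split; rewrite ?ltNge ?[(_ <= Num.floor _)%R]leNgt ?negbK; apply/negP => lt; apply: nF.
    left; case: c => /andP[_ /le_trans le_p] _; apply: le_p; rewrite ler_int; lia.
  right; left; case: c => /andP[le_p _] _; apply: le_trans le_p; rewrite ler_int; lia.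
- apply/andP; split; rewrite ?ltNge ?[(_ <= Num.floor _)%R]leNgt ?negbK; apply/negP => lt; apply: nF; right; right.
    left; case: c => _ /andP[_ /le_trans le_p]; apply: le_p; rewrite ler_int; lia.
  right; case: c => _ /andP[le_p _]; apply: le_trans le_p; rewrite ler_int; lia.
Qed.

Lemma in_and_out p : in_cells p -> out_cells p -> L p.
Proof.
move=> [x [y [i c]]] [F|[x' [y' [ni _ _ c']]]]; last exact: boundary_in_loop c c' i ni.
have [xb yb] := inside_box ld i; have [/andP[cx1 cx2] /andP[cy1 cy2]] := c.
have xint (z : int) : z%:~R <= p.1 -> p.1 <= z%:~R -> p.1 = z%:~R by move=> a b; apply/eqP; rewrite eq_le a b.
have yint (z : int) : z%:~R <= p.2 -> p.2 <= z%:~R -> p.2 = z%:~R by move=> a b; apply/eqP; rewrite eq_le a b.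
case: F => [F|[F|[F|F]]].
- apply: (boundary_in_loop c (_ : cell (x - 1) y p) i).
    split; last by rewrite cy1 cy2.
    rewrite subrK (le_trans F) ?ler_int ?andbT; last by lia.
    by apply: le_trans cx1; rewrite ler_int; lia.
  rewrite inside_left //; have : x <= x0 by rewrite -(ler_int R); apply: le_trans F.
  lia.
- apply: (boundary_in_loop c (_ : cell (x + 1) y p) i).
    split; last by rewrite cy1 cy2.
    rewrite (le_trans _ F) ?ler_int /=; last by lia.
    by apply: le_trans cx2 _; rewrite ler_int; lia.
  rewrite (inside_right ld) //; have : x0 + w%:Z <= x + 1 by rewrite -(ler_int R); apply: le_trans F _.
  lia.
- apply: (boundary_in_loop c (_ : cell x (y - 1) p) i).
    split; first by rewrite cx1 cx2.
    rewrite subrK (le_trans F) ?ler_int ?andbT; last by lia.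
    by apply: le_trans cy1; rewrite ler_int; lia.
  rewrite (inside_below ld) //; have : y <= y0 by rewrite -(ler_int R); apply: le_trans F.
  lia.
- apply: (boundary_in_loop c (_ : cell x (y + 1) p) i).
    split; first by rewrite cx1 cx2.
    rewrite (le_trans _ F) ?ler_int /=; last by lia.
    by apply: le_trans cy2 _; rewrite ler_int; lia.
  rewrite (inside_above ld) //; have : y0 + h%:Z <= y + 1 by rewrite -(ler_int R); apply: le_trans F _.
  lia.
Qed.

(** Two closed sets that cover the plane and meet only in [L] cut the
    complement of [L] into two open parts. *)
Lemma connected_side (A B X : set (R * R)) : closed A -> closed B -> (forall p, A p \/ B p) ->
  (forall p, A p -> B p -> L p) -> connected X -> X `<=` ~` L -> (exists2 p, X p & A p) -> X `<=` A.
Proof.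
move=> cA cB AB ABL cX XL [p Xp Ap].
suff : X `&` A = X by move/setIidPl.
apply: cX; [by exists p | | by exists A].
exists (~` B); first exact: closed_openC.
apply/seteqP; split=> q [Xq]; first by move=> Aq; split=> // Bq; apply: (XL q Xq); apply: ABL.
by move=> nB; split=> //; case: (AB q).
Qed.

(** By [connected_side] the component of [p] stays in the bounded set
    [in_cells]. *)
Lemma enclosed_of_in p : in_cells p -> ~ L p -> enclosed L p.
Proof.
move=> Kp nLp; split=> //; apply/bounded_coords.
have sub : connected_component (~` L) p `<=` in_cells.
  apply: (connected_side closed_in_cells closed_out_cells in_or_out in_and_out).
  - exact: component_connected.
  - exact: connected_component_sub.
  - by exists p => //; apply: connected_component_refl.
exists (`|x0%:~R| + `|(x0 + w%:Z)%:~R| + `|y0%:~R| + `|(y0 + h%:Z)%:~R|) => q /sub [x [y [i [/andP[a b] /andP[c d]]]]].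
have [xb yb] := inside_box ld i.
have l1 : x0%:~R <= x%:~R :> R by rewrite ler_int; lia.
have l2 : (x + 1)%:~R <= (x0 + w%:Z)%:~R :> R by rewrite ler_int; lia.
have l3 : y0%:~R <= y%:~R :> R by rewrite ler_int; lia.
have l4 : (y + 1)%:~R <= (y0 + h%:Z)%:~R :> R by rewrite ler_int; lia.
have := ler_norm (x0%:~R : R); have := ler_norm ((x0 + w%:Z)%:~R : R).
have := ler_norm (y0%:~R : R); have := ler_norm ((y0 + h%:Z)%:~R : R).
have := ler_norm (- x0%:~R : R); have := ler_norm (- (x0 + w%:Z)%:~R : R).
have := ler_norm (- y0%:~R : R); have := ler_norm (- (y0 + h%:Z)%:~R : R).
rewrite !normrN; lra.
Qed.


(** The centre of the cell lies in the component of [p]. *)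
Definition escapes p (x y : int) : Prop := connected_component (~` L) p (center x y).

Lemma center_not_loop x y : ~ L (center x y).
Proof.
move=> /(loop_cover loopL)[[k i|j k] _ /=].
  by move=> [_ /esym /int_neq_half].
by move=> [/esym /int_neq_half].
Qed.

Lemma connected_escape p (A : set (R * R)) q r : connected_component (~` L) p q ->
  connected A -> A `<=` ~` L -> A q -> A r -> connected_component (~` L) p r.
Proof.
move=> pq cA AL Aq Ar; apply: connected_component_trans pq _.
exact: (connected_component_max Aq AL cA).
Qed.

(** The segment between the centres of adjacent cells meets no stitch but
    the one between them. *)
Lemma escape_right p x y : ~~ V (x + 1) y -> escapes p x y <-> escapes p (x + 1) y.
Proof.
move=> nV; pose A := [set q : R * R | x%:~R + 2^-1 <= q.1 <= (x + 1)%:~R + 2^-1 /\ q.2 = y%:~R + 2^-1].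
have cA : connected A by exact: connected_hor.
have half : (0 < 2^-1 :> R) by rewrite invr_gt0 ltr0n.
have AL : A `<=` ~` L.
  move=> q [qx qy] /(loop_cover loopL)[[k i|j k] sL /=].
    by move=> [_]; rewrite qy => /esym /int_neq_half.
  move=> [qj]; rewrite qy => /andP[/int_lt_half l1 /int_half_lt l2].
  case/negP: nV; apply/asboolP; rewrite (_ : y = k); last by lia.
  rewrite (_ : x + 1 = j) //; move: qx; rewrite qj => /andP[a b].
  have l3 := int_lt_half b; suff : x < j by lia.
  by rewrite -(ltr_int R); lra.
have A1 : A (center x y) by split=> //=; rewrite lexx /= intrD; lra.
have A2 : A (center (x + 1) y) by split=> //=; rewrite lexx andbT intrD; lra.
by split=> esc; apply: (connected_escape esc cA AL).
Qed.

Lemma escape_up p x y : ~~ H x (y + 1) -> escapes p x y <-> escapes p x (y + 1).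
Proof.
move=> nH; pose A := [set q : R * R | q.1 = x%:~R + 2^-1 /\ y%:~R + 2^-1 <= q.2 <= (y + 1)%:~R + 2^-1].
have cA : connected A by exact: connected_ver.
have half : (0 < 2^-1 :> R) by rewrite invr_gt0 ltr0n.
have AL : A `<=` ~` L.
  move=> q [qx qy] /(loop_cover loopL)[[k i|j k] sL /=]; last first.
    by move=> []; rewrite qx => /esym /int_neq_half.
  move=> [] /[swap] qi; rewrite qx => /andP[/int_lt_half l1 /int_half_lt l2].
  case/negP: nH; apply/asboolP; rewrite (_ : x = k); last by lia.
  rewrite (_ : y + 1 = i) //; move: qy; rewrite qi => /andP[a b].
  have l3 := int_lt_half b; suff : y < i by lia.
  by rewrite -(ltr_int R); lra.
have A1 : A (center x y) by split=> //=; rewrite lexx /= intrD; lra.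
have A2 : A (center x (y + 1)) by split=> //=; rewrite lexx andbT intrD; lra.
by split=> esc; apply: (connected_escape esc cA AL).
Qed.

(** The half-open segment from the centre of a cell to one of its points lies
    in the open cell. *)
Lemma escape_start p : ~ L p -> escapes p (Num.floor p.1) (Num.floor p.2).
Proof.
move=> nLp; pose g (t : R) : R * R := p + t *: (center (Num.floor p.1) (Num.floor p.2) - p).
have f1 := floor_le_tmp p.1; have f1' := floorD1_gt p.1.
have f2 := floor_le_tmp p.2; have f2' := floorD1_gt p.2.
have half : (0 < 2^-1 :> R) by rewrite invr_gt0 ltr0n.
have half1 : 2^-1 + 2^-1 = 1 :> R by lra.
apply: (connected_component_max (B := g @` `[0, 1])).
- by exists 0; rewrite /= ?in_itv /= ?lexx ?ler01 // /g scale0r addr0.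
- move=> _ [t /= t01 <-] Lt; rewrite in_itv /= in t01.
  have [t0|t0] := eqVneq t 0; first by apply: nLp; move: Lt; rewrite /g t0 scale0r addr0.
  have tp : 0 < t by rewrite lt_def t0; case/andP: t01.
  have [_ t1] := andP t01.
  have [[k i|j k] _ [E1 E2]] := loop_cover loopL Lt.
    exact: between_ints (toward_half tp t1 f2 f2') E2.
  exact: between_ints (toward_half tp t1 f1 f1') E1.
- apply: connected_continuous_connected; first exact: segment_connected.
  apply: continuous_subspaceT => t.
  apply: cvgD; first exact: cvg_cst.
  by apply: cvgZr_tmp; exact: cvg_id.
by exists 1; rewrite /= ?in_itv /= ?lexx ?ler01 // /g scale1r addrC subrK.
Qed.

Lemma escape_outside p x y : out_cells p -> ~ L p -> escapes p x y -> ~~ ins x y.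
Proof.
move=> Op nLp esc; apply/negP => i.
have sub : connected_component (~` L) p `<=` out_cells.
  apply: (connected_side closed_out_cells closed_in_cells (A := out_cells) (B := in_cells)).
  - by move=> q; case: (in_or_out q); auto.
  - by move=> q Oq Iq; exact: in_and_out.
  - exact: component_connected.
  - exact: connected_component_sub.
  - by exists p => //; apply: connected_component_refl.
apply: (@center_not_loop x y); apply: in_and_out (sub _ esc).
have half : (0 < 2^-1 :> R) by rewrite invr_gt0 ltr0n.
by exists x, y; split=> //; split; rewrite /= intrD; lra.
Qed.

(** At a vertex of the loop the two non-loop edges connect the three cells of
    the outer corner.  Hence if one of the two stitches at the vertex borders a
    cell reached from [p], then so does the other, and either all stitches of
    the loop border such cells or none does.  If none does, every step to the
    left is possible.  If all do, the leftmost stitch does, at its outer side,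
    and from there nothing obstructs the way to the left. *)
Lemma escapes_all p : out_cells p -> ~ L p -> exists x y, forall n : nat, escapes p (x - n%:Z) y.
Proof.
move=> Op nLp; have start := escape_start nLp.
have T x y : escapes p x y -> ~~ ins x y by exact: escape_outside.
pose phiH k i := `[< escapes p k i \/ escapes p k (i - 1) >].
pose phiV j k := `[< escapes p j k \/ escapes p (j - 1) k >].
have iffR x y : ~~ V x y -> escapes p (x - 1) y <-> escapes p x y.
  by move=> nV; have := @escape_right p (x - 1) y; rewrite subrK; apply.
have iffU x y : ~~ H x y -> escapes p x (y - 1) <-> escapes p x y.
  by move=> nH; have := @escape_up p x (y - 1); rewrite subrK; apply.
have [|c [cH cV]] := ld_connected ld (phiH := phiH) (phiV := phiV).
  move=> k i k' i' kk ii Hk Vk; apply: asbool_equiv_eq.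
  have hx := ld_hexcl ld k i; have vx := ld_vexcl ld k i.
  case: kk Hk hx => -> Hk; rewrite Hk ?andbT /= => hx; case: ii Vk vx => -> Vk; rewrite Vk ?andbT /= => vx.
  - by have := iffR k i vx; have := iffU k i hx; tauto.
  - by have := iffR k (i - 1) vx; have := iffU k i hx; tauto.
  - by have := iffR k i vx; have := iffU (k - 1) i hx; tauto.
  - by have := iffR k (i - 1) vx; have := iffU (k - 1) i hx; tauto.
(* Whether the stitches of the loop border cells reached from [p]. *)
case: c cH cV => cH cV.
  have [l Vl] := ld_left ld; have /asboolP := cV _ _ Vl.
  have insl : ins x0 l.
    by have := inside_vstep ld x0 l; rewrite Vl (@inside_left _ _ (x0 - 1)) ?addbF //; lia.
  move=> [/T|esc]; first by rewrite insl.
  exists (x0 - 1), l; elim=> [|n IH]; first by rewrite subr0.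
  have -> : x0 - 1 - n.+1%:Z = x0 - 1 - n%:Z - 1 by lia.
  by apply/iffR => //; apply/negP => /(ld_vbox ld); lia.
exists (Num.floor p.1), (Num.floor p.2); elim=> [|n IH]; first by rewrite subr0.
set x := Num.floor p.1 - n%:Z in IH.
have -> : Num.floor p.1 - n.+1%:Z = x - 1 by rewrite /x; lia.
apply/iffR => //; apply/negP => /cV /asboolP; apply; by left.
Qed.

Lemma in_of_enclosed p : enclosed L p -> in_cells p.
Proof.
move=> [nLp /bounded_coords[M bnd]]; case: (in_or_out p) => // Op.
have [x [y esc]] := escapes_all Op nLp.
have [N MN] : exists N : nat, M + `|x%:~R| + 1 < N%:R.
  exists (Num.bound (`|M| + `|x%:~R| + 1)).
  have b0 : 0 <= `|M| + `|x%:~R| + 1 by rewrite !addr_ge0.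
  by apply: le_lt_trans (archi_boundP b0); rewrite !lerD2r ler_norm.
have [/andP[l1 _] _] := bnd _ (esc N).
move: l1; rewrite /= intrB; have := ler_norm (x%:~R : R).
have : (N%:Z)%:~R = N%:R :> R by [].
have : 2^-1 < 1 :> R by rewrite invf_lt1 ?ltr0n // ltr1n.
lra.
Qed.

Lemma enclosedE : enclosed L = in_cells `\` L.
Proof.
apply/seteqP; split=> p.
  by move=> encl; split; [exact: in_of_enclosed | case: encl].
by case; exact: enclosed_of_in.
Qed.

End Area.

(** * The area of a loop *)

Section Measure.
Variables (R : realType) (e f : int -> bool) (P : set stitch) (L : set (R * R)).
Variables (x0 y0 : int) (w h : nat).
Hypothesis loopL : loop_of P L.
Local Notation H := (hstitch_in L).
Local Notation V := (vstitch_in L).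
Hypothesis ld : loop_data x0 y0 w h e f H V.
Local Notation ins := (inside x0 V).
Local Notation muM := (product_measure1 (@lebesgue_measure R) (@lebesgue_measure R)).

Lemma measurable_rect (a b c d : R) (b1 b2 b3 b4 : bool) :
  measurable ([set` Interval (BSide b1 a) (BSide b2 b)] `*` [set` Interval (BSide b3 c) (BSide b4 d)] : set (R * R)).
Proof. by apply: measurableX; exact: measurable_itv. Qed.

Lemma cellE x y : @cell R x y = `[x%:~R, (x + 1)%:~R] `*` `[y%:~R, (y + 1)%:~R].
Proof. by apply/seteqP; split=> -[p1 p2]; rewrite /cell /= !in_itv. Qed.

Lemma open_cellE x y : @open_cell R x y = `]x%:~R, (x + 1)%:~R[ `*` `]y%:~R, (y + 1)%:~R[.
Proof. by apply/seteqP; split=> -[p1 p2]; rewrite /open_cell /= !in_itv. Qed.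

Lemma measurable_cell x y : measurable (@cell R x y).
Proof. by rewrite cellE; exact: measurable_rect. Qed.

Lemma measurable_open_cell x y : measurable (@open_cell R x y).
Proof. by rewrite open_cellE; exact: measurable_rect. Qed.

Lemma measure_unit_itv (x : int) b1 b2 :
  lebesgue_measure [set` Interval (BSide b1 (x%:~R : R)) (BSide b2 (x + 1)%:~R)] = 1%E.
Proof.
rewrite lebesgue_measure_itv /= lte_fin ltr_int ltrDl ltr01.
by rewrite -EFinB -intrB addrC addKr.
Qed.

Lemma measure_cell x y : muM (@cell R x y) = 1%E.
Proof.
rewrite cellE; apply: etrans (product_measure1E _ _ _ _) _; try exact: measurable_itv.
exact: etrans (f_equal2 mule (measure_unit_itv _ _ _) (measure_unit_itv _ _ _)) (mule1 _).
Qed.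

Lemma measure_open_cell x y : muM (@open_cell R x y) = 1%E.
Proof.
rewrite open_cellE; apply: etrans (product_measure1E _ _ _ _) _; try exact: measurable_itv.
exact: etrans (f_equal2 mule (measure_unit_itv _ _ _) (measure_unit_itv _ _ _)) (mule1 _).
Qed.

Lemma measurable_stitch s : measurable (segment s : set (R * R)).
Proof.
case: s => k i.
  rewrite (_ : segment _ = `[k%:~R, (k + 1)%:~R] `*` `[i%:~R, i%:~R]); first exact: measurable_rect.
  by apply/seteqP; split=> -[p1 p2] /=; rewrite !in_itv /= -eq_le => -[->]; [move=> ->; rewrite eqxx|move=> /eqP ->].
rewrite (_ : segment _ = `[k%:~R, k%:~R] `*` `[i%:~R, (i + 1)%:~R]); first exact: measurable_rect.
by apply/seteqP; split=> -[p1 p2] /=; rewrite !in_itv /= -eq_le => -[]; [move=> -> ->; rewrite eqxx|move=> /eqP ->].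
Qed.

Lemma measurable_loop : measurable L.
Proof.
rewrite (_ : L = \bigcup_(v in [set: int * int]) (if H v.1 v.2 then segment (HStitch v.1 v.2) else set0) `|`
   \bigcup_(v in [set: int * int]) (if V v.1 v.2 then segment (VStitch v.1 v.2) else set0)).
  by apply: measurableU; apply: countable_bigcupT_measurable => // v;
    case: ifP => _ //; exact: measurable_stitch.
apply/seteqP; split=> [x /(loop_cover loopL)[[k i|j k] sL sx]|x [] [v _]].
- by left; exists (k, i) => //=; rewrite (_ : H k i = true) //; apply/asboolP.
- by right; exists (j, k) => //=; rewrite (_ : V j k = true) //; apply/asboolP.
- by case: ifP => // /asboolP sL sx; apply: sL.
- by case: ifP => // /asboolP sL sx; apply: sL.
Qed.

Definition cells_of (D : int -> int -> set (R * R)) (r : seq (int * int)) : set (R * R) :=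
  \big[setU/set0]_(v <- r) D v.1 v.2.

Lemma cells_ofP D r p : cells_of D r p <-> exists2 v, v \in r & D v.1 v.2 p.
Proof.
rewrite /cells_of -bigcup_seq; split=> [[v vr vp]|[v vr vp]]; by exists v.
Qed.

Lemma measurable_cells_of D r : (forall x y, measurable (D x y)) -> measurable (cells_of D r).
Proof. by move=> mD; apply: bigsetU_measurable => v _. Qed.

Lemma measure_cells_le r : (muM (cells_of (@cell R) r) <= (size r)%:R%:E)%E.
Proof.
rewrite /cells_of; elim: r => [|v r IH]; first by rewrite big_nil measure0.
rewrite big_cons; apply: le_trans (measureU2 _ _ _) _.
- exact: measurable_cell.
- by apply: measurable_cells_of => x y; exact: measurable_cell.
rewrite /= -natr1 EFinD addeC; apply: leeD; last exact: IH.
have le1 : (muM (@cell R v.1 v.2) <= 1)%E by rewrite measure_cell.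
exact: le1.
Qed.

Lemma open_cell_inj x y x' y' (p : R * R) :
  @open_cell R x y p -> @open_cell R x' y' p -> (x, y) = (x', y').
Proof.
move=> [/andP[a b] /andP[c d]] [/andP[a' b'] /andP[c' d']].
have l1 : x < x' + 1 by rewrite -(ltr_int R); apply: lt_trans b'.
have l2 : x' < x + 1 by rewrite -(ltr_int R); apply: lt_trans b.
have l3 : y < y' + 1 by rewrite -(ltr_int R); apply: lt_trans d'.
have l4 : y' < y + 1 by rewrite -(ltr_int R); apply: lt_trans d.
by congr pair; lia.
Qed.

Lemma measure_open_cells r : uniq r -> muM (cells_of (@open_cell R) r) = (size r)%:R%:E.
Proof.
rewrite /cells_of; elim: r => [|v r IH] /=; first by rewrite big_nil measure0.
move=> /andP[vr /IH E]; rewrite big_cons measureU.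
- by apply: etrans (f_equal2 adde (measure_open_cell _ _) E) _; rewrite -natr1 EFinD addeC.
- exact: measurable_open_cell.
- by apply: measurable_cells_of => x y; exact: measurable_open_cell.
apply/seteqP; split=> // p [pv /cells_ofP[v' v'r pv']].
case: v v' vr pv v'r pv' {E} => [x y] [x' y'] vr pv v'r pv'.
by case/negP: vr; rewrite (open_cell_inj pv pv').
Qed.

Definition inside_cells : seq (int * int) :=
  flatten [seq [seq (x0 + x%:Z, y0 + y%:Z) | y <- iota 0 h & window x0 y0 V x y] | x <- iota 0 w].

Lemma size_inside_cells : size inside_cells = cell_count w h (window x0 y0 V).
Proof.
rewrite size_flatten sumnE /shape -map_comp big_map /cell_count /index_iota subn0.
apply: eq_bigr => x _ /=; rewrite size_map size_filter -sum1_count subn0.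
by rewrite big_mkcond /=.
Qed.

Lemma mem_inside_cells v : (v \in inside_cells) = ins v.1 v.2.
Proof.
apply/flattenP/idP => [[s /mapP[x _ ->] /mapP[y]]|insv].
  by rewrite mem_filter => /andP[win _] ->.
have [xb yb] := inside_box ld insv; case: v insv xb yb => [x y] /= insv xb yb.
have Ex : x0 + (absz (x - x0)%R)%:Z = x by lia.
have Ey : y0 + (absz (y - y0)%R)%:Z = y by lia.
exists [seq (x0 + (absz (x - x0)%R)%:Z, y0 + y'%:Z) | y' <- iota 0 h & window x0 y0 V (absz (x - x0)%R) y'].
  by apply/mapP; exists (absz (x - x0)%R) => //; rewrite mem_iota; lia.
apply/mapP; exists (absz (y - y0)%R); last by rewrite Ex Ey.
by rewrite mem_filter /window Ex Ey insv mem_iota; lia.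
Qed.

Lemma uniq_inside_cells : uniq inside_cells.
Proof.
rewrite /inside_cells; apply: allpairs_uniq_dep; first exact: iota_uniq.
  by move=> x _; apply: filter_uniq; exact: iota_uniq.
move=> [x y] [x' y'] _ _ /= [Ex Ey].
have -> : x = x' by lia.
by have -> : y = y' by lia.
Qed.

Lemma in_cellsE : in_cells L x0 = cells_of (@cell R) inside_cells.
Proof.
apply/seteqP; split=> p.
  by move=> [x [y [i c]]]; apply/cells_ofP; exists (x, y); rewrite ?mem_inside_cells.
by move=> /cells_ofP[[x y]]; rewrite mem_inside_cells => i c; exists x, y.
Qed.

(** The enclosed set is the union of the closed cells inside the loop, less the
    loop; it lies between the union of the open cells and that of the closed
    cells, which have the same measure. *)
Theorem area_loop : area L = (cell_count w h (window x0 y0 V))%:R%:E.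
Proof.
rewrite /area (enclosedE loopL ld) in_cellsE -size_inside_cells.
have mK := measurable_cells_of inside_cells measurable_cell.
have mO := measurable_cells_of inside_cells measurable_open_cell.
have mKL : measurable (cells_of (@cell R) inside_cells `\` L) by apply: measurableD => //; exact: measurable_loop.
apply/eqP; rewrite eq_le; apply/andP; split.
  apply: le_trans (measure_cells_le inside_cells).
  by apply: (@le_measure _ _ _ muM); rewrite ?inE // => p [].
rewrite -(measure_open_cells uniq_inside_cells).
apply: (@le_measure _ _ _ muM); rewrite ?inE // => p /cells_ofP[[x y] vr [/= xp yp]].
split.
  by apply/cells_ofP; exists (x, y) => //; case/andP: xp => a b; case/andP: yp => c d; split; rewrite /= !ltW.
move=> /(loop_cover loopL)[[k i|j k] _ []].
  by move=> _ E; apply: between_ints yp E.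
by move=> E _; apply: between_ints xp E.
Qed.

End Measure.

(** * Translations, and the proof of the theorem *)

Definition shift (m n : int) (s : stitch) : stitch :=
  match s with HStitch k i => HStitch (k + m) (i + n) | VStitch j k => VStitch (j + m) (k + n) end.

Lemma shiftK m n s : shift (- m) (- n) (shift m n s) = s.
Proof. by case: s => k i /=; rewrite !addrK. Qed.

Lemma shiftNK m n s : shift m n (shift (- m) (- n) s) = s.
Proof. by case: s => k i /=; rewrite !subrK. Qed.

Section Translation.
Variable R : realType.
Implicit Types (A X L : set (R * R)) (p v : R * R) (P : set stitch).

Definition translate v A : set (R * R) := [set p + v | p in A].

Lemma translateE v A q : translate v A q <-> A (q - v).
Proof.
split=> [[p Ap <-]|Aq]; first by rewrite addrK.
by exists (q - v); rewrite ?subrK.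
Qed.

Lemma translateK v A : translate (- v) (translate v A) = A.
Proof. by apply/seteqP; split=> p; rewrite !translateE opprK addrK. Qed.

Lemma connected_translate v X : connected X -> connected (translate v X).
Proof.
move=> cX; apply: connected_continuous_connected => //.
apply: continuous_subspaceT => p.
by apply: cvgD; [exact: cvg_id | exact: cvg_cst].
Qed.

Lemma translate_component_sub v A p : A p ->
  translate v (connected_component A p) `<=` connected_component (translate v A) (p + v).
Proof.
move=> Ap; apply: connected_component_max.
- by apply/translateE; rewrite addrK; exact: connected_component_refl.
- by move=> q /translateE /connected_component_sub Aq; apply/translateE.
- by apply: connected_translate; exact: component_connected.
Qed.

(** Translation by the opposite vector gives the second inclusion. *)
Lemma translate_component v A p : A p ->
  connected_component (translate v A) (p + v) = translate v (connected_component A p).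
Proof.
move=> Ap; apply/seteqP; split; last exact: translate_component_sub.
move=> q cq; apply/translateE.
have Apv : translate v A (p + v) by apply/translateE; rewrite addrK.
have := @translate_component_sub (- v) _ _ Apv (q - v).
by rewrite translateK addrK; apply; apply/translateE; rewrite opprK subrK.
Qed.

Lemma bounded_translate v A : bounded_set A -> bounded_set (translate v A).
Proof.
move=> /bounded_coords[M AM]; apply/bounded_coords.
exists (M + (`|v.1| + `|v.2|)) => q /translateE /AM /= [].
have := ler_norm v.1; have := ler_norm v.2; have := ler_norm (- v.1); have := ler_norm (- v.2).
rewrite !normrN; have := normr_ge0 v.1; have := normr_ge0 v.2; lra.
Qed.

Definition int_vec (m n : int) : R * R := (m%:~R, n%:~R).

Lemma segment_shift m n s : segment (shift m n s) = translate (int_vec m n) (segment s).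
Proof.
apply/seteqP; split=> -[q1 q2].
  by rewrite translateE; case: s => k i /=; rewrite !intrD => -[a b]; split; lra.
by rewrite translateE; case: s => k i /=; rewrite !intrD => -[a b]; split; lra.
Qed.

Lemma stitches_in_shift m n L s :
  stitches_in (translate (int_vec m n) L) (shift m n s) <-> stitches_in L s.
Proof.
rewrite /stitches_in /= segment_shift; split=> sub q.
  by have := sub (q + int_vec m n); rewrite !translateE addrK.
by rewrite !translateE; apply: sub.
Qed.

Lemma loop_of_translate m n P L : loop_of P L ->
  loop_of [set s | P (shift (- m) (- n) s)] (translate (int_vec m n) L).
Proof.
have E : stitch_union [set s | P (shift (- m) (- n) s)] = translate (int_vec m n) (stitch_union P).
  apply/seteqP; split=> q.
    move=> [s Ps sq]; apply/translateE; exists (shift (- m) (- n) s) => //.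
    by move: sq; rewrite -{1}(shiftNK m n s) segment_shift translateE.
  move=> /translateE[s Ps sq]; exists (shift m n s); first by rewrite /= shiftK.
  by rewrite segment_shift translateE.
move=> [p [Pp LE bL]]; exists (p + int_vec m n); split.
- by rewrite E; apply/translateE; rewrite addrK.
- by rewrite E LE translate_component.
- exact: bounded_translate.
Qed.

Lemma longitude_shift m n s : longitude R (shift m n s) = longitude R s + m%:~R.
Proof. by case: s => k i; rewrite /longitude /= intrD //; lra. Qed.

Lemma latitude_shift m n s : latitude R (shift m n s) = latitude R s + n%:~R.
Proof. by case: s => k i; rewrite /latitude /= intrD //; lra. Qed.

Lemma has_width_translate m n L (w : R) : has_width L w -> has_width (translate (int_vec m n) L) w.
Proof.
move=> [[s sL [t tL E]] ub]; split.
  exists (shift m n s); first exact/stitches_in_shift.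
  exists (shift m n t); first exact/stitches_in_shift.
  by rewrite !longitude_shift -E; lra.
move=> _ [s' s'L [t' t'L <-]]; apply: ub.
rewrite -(shiftNK m n s') in s'L *; rewrite -(shiftNK m n t') in t'L *.
exists (shift (- m) (- n) s'); first by move/stitches_in_shift: s'L.
exists (shift (- m) (- n) t'); first by move/stitches_in_shift: t'L.
by rewrite !(longitude_shift m n); lra.
Qed.

Lemma has_height_translate m n L (h : R) : has_height L h -> has_height (translate (int_vec m n) L) h.
Proof.
move=> [[s sL [t tL E]] ub]; split.
  exists (shift m n s); first exact/stitches_in_shift.
  exists (shift m n t); first exact/stitches_in_shift.
  by rewrite !latitude_shift -E; lra.
move=> _ [s' s'L [t' t'L <-]]; apply: ub.
rewrite -(shiftNK m n s') in s'L *; rewrite -(shiftNK m n t') in t'L *.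
exists (shift (- m) (- n) s'); first by move/stitches_in_shift: s'L.
exists (shift (- m) (- n) t'); first by move/stitches_in_shift: t'L.
by rewrite !(latitude_shift m n); lra.
Qed.

(** The extremes of the loop are the sides of its bounding box, a description
    of the box that real translations respect. *)
Lemma loop_extent e f P L (x0 y0 : int) (w h : nat) : loop_of P L ->
  loop_data x0 y0 w h e f (hstitch_in L) (vstitch_in L) ->
  [/\ forall p, L p -> x0%:~R <= p.1 <= x0%:~R + w%:R /\ y0%:~R <= p.2 <= y0%:~R + h%:R,
      (exists2 p, L p & p.1 = x0%:~R), (exists2 p, L p & p.1 = x0%:~R + w%:R),
      (exists2 p, L p & p.2 = y0%:~R) & (exists2 p, L p & p.2 = y0%:~R + h%:R)].
Proof.
move=> loopL ld.
have mid s : stitches_in L s -> L (midpoint R s) by apply; exact: midpoint_segment.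
split.
- move=> p /(loop_cover loopL)[[k i|j k] /asboolP sL /=].
    have [/andP[k1 k2] /andP[i1 i2]] := ld_hbox ld sL.
    move: k1 k2 i1 i2; rewrite -!(ler_int R) -lezD1 -(ler_int R) !intrD => k1 k2 i1 i2.
    by move=> [/andP[p1 p2] ->]; split; apply/andP; split; lra.
  have [/andP[k1 k2] /andP[i1 i2]] := ld_vbox ld sL.
  move: k1 k2 i1 i2; rewrite -lezD1 -!(ler_int R) !intrD => k1 k2 i1 i2.
  by move=> [-> /andP[p1 p2]]; split; apply/andP; split; lra.
- by have [k /asboolP sL] := ld_left ld; exists (midpoint R (VStitch x0 k)); first exact: mid.
- have [k /asboolP sL] := ld_right ld; exists (midpoint R (VStitch (x0 + w%:Z) k)); first exact: mid.
  by rewrite /= intrD.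
- by have [k /asboolP sL] := ld_bottom ld; exists (midpoint R (HStitch k y0)); first exact: mid.
have [k /asboolP sL] := ld_top ld; exists (midpoint R (HStitch k (y0 + h%:Z))); first exact: mid.
by rewrite /= intrD.
Qed.

End Translation.

Lemma line_type_shift b lab (z : int) (n : nat) c :
  line_type b lab (z + n%:Z) = (odd n (+) (lab (z + n%:Z) (+) c) == (b (+) oddz z (+) c)).
Proof.
rewrite /line_type oddzD oddz_nat.
by case: (oddz z); case: (odd n); case: (lab _); case: b; case: c.
Qed.

(** With inner cells at even places, the stitches on line [i] have parity
    [g i], and the line has type [T i] exactly if [i] and [g i] have the same
    parity. *)
Lemma labels_of_cross_type n r (g : int -> bool) (T : nat -> bool) : odd n -> cross_type n r T ->
  (forall i : nat, T i = ~~ (odd i (+) g i%:Z)) -> T 0%N -> ~~ T n ->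
  forall i : nat, (i <= n)%N -> (g i%:Z)%:R = (if i \in [:: 0; r.+1.-1; r.+1; n]%N then 0 else 1) :> 'Z_2.
Proof.
move=> on ct TE T0 Tn i le_in; rewrite !inE [r.+1.-1]/=.
have [->|i0] := posnP i; first by move: T0; rewrite TE; case: (g 0).
have [->|ne_in] := eqVneq i n.
  by rewrite !orbT; move: Tn; rewrite TE on negbK; case: (g n).
have := TE i; rewrite ct; last by rewrite i0 ltn_neqAle ne_in.
rewrite orFb orbF.
by case: ((i == r) || (i == r.+1)); case: (g i%:Z); case: (odd i).
Qed.

Lemma cross_type_of_labels n r (lab : int -> bool) (g : int -> 'Z_2) : (0 < r)%N ->
  (forall i : nat, (i <= n)%N -> g i%:Z = if i \in [:: 0; r.-1; r; n]%N then 0 else 1) ->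
  (forall z, lab z = (g z == 1)) -> cross_type n r.-1 (fun j => line_type false lab (0 + j%:Z)).
Proof.
move=> r0 gE labE j /andP[j0 jn]; rewrite /line_type add0r labE gE ?(ltnW jn) // !inE.
rewrite (gtn_eqF j0) (ltn_eqF jn) orFb orbF (prednK r0) oddz_nat.
by case: ((j == r.-1) || (j == r)); case: (odd j).
Qed.

Lemma extent_unique (R : realType) (x x' v a a' : R) :
  x' <= x - v <= x' + a' -> x' <= x + a - v <= x' + a' ->
  x <= x' + v <= x + a -> x <= x' + a' + v <= x + a -> v = x - x' /\ a' = a.
Proof. by move=> /andP[? _] /andP[_ ?] /andP[? _] /andP[_ ?]; split; lra. Qed.

Section Analysis.
Variables (R : realType) (w h : nat) (L : set (R * R)).
Hypotheses (w_odd : odd w) (h_odd : odd h) (w_ge3 : (3 <= w)%N) (h_ge3 : (3 <= h)%N).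

Lemma area_eq_nat (n : nat) : (n%:R%:E = (2 * (w%:R + h%:R) - 7)%:E :> \bar R) <-> (n + 7 = 2 * (w + h))%N.
Proof.
split=> [[E]|E]; last first.
  congr EFin; have : (n + 7)%:R = (2 * (w + h))%:R :> R by rewrite E.
  by rewrite natrM !natrD; lra.
by apply/eqP; rewrite -(eqr_nat R) natrM !natrD; apply/eqP; lra.
Qed.

(** [extremal_cross] determines the types of all lines that meet the box, and
    these determine the labels, up to the translation that moves the box to the
    origin. *)
Lemma extremal_is_cross e f P : labelled e f P -> loop_of P L ->
  has_width L w%:R -> has_height L h%:R -> (5 <= w)%N -> (5 <= h)%N ->
  area L = (2 * (w%:R + h%:R) - 7)%:E -> is_cross L.
Proof.
move=> Plab loopL hw hh w5 h5.
have [x0 [y0 ld]] := loop_data_of_loop Plab loopL hw hh.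
have [a [b [cfg bE u0 t0 [uw th]]]] := loop_data_config ld w_ge3.
rewrite (area_loop loopL ld) area_eq_nat => ext.
have [p [q [[ep eq_ pl ql] [a0 uc tc]]]] := extremal_cross cfg w5 h5 w_odd h_odd ext.
pose C := translate (int_vec R (- x0) (- y0)) L.
pose P' := [set s | P (shift x0 y0 s)].
have loopC : loop_of P' C.
  by have := loop_of_translate (- x0) (- y0) loopL; rewrite !opprK.
pose e' i := e (y0 + i) (+) oddz x0.
pose f' j := f (x0 + j) (+) oddz y0.
have lab' : labelled e' f' P'.
  split=> k i; rewrite /P' /= ?Plab.1 ?Plab.2 oddzD.
    by rewrite /e' [i + y0]addrC; case: (oddz k); case: (oddz x0); case: (e _).
  by rewrite /f' [k + x0]addrC; case: (oddz i); case: (oddz y0); case: (f _).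
have b0 : b = oddz x0 (+) oddz y0 by rewrite bE a0.
have tE (i : nat) : line_type b e (y0 + i%:Z) = ~~ (odd i (+) e' i%:Z).
  by rewrite (line_type_shift _ _ _ _ (oddz x0)) b0 -/(e' i%:Z); case: (oddz x0); case: (oddz y0); case: odd; case: (e' _).
have uE (j : nat) : line_type b f (x0 + j%:Z) = ~~ (odd j (+) f' j%:Z).
  by rewrite (line_type_shift _ _ _ _ (oddz y0)) b0 -/(f' j%:Z); case: (oddz x0); case: (oddz y0); case: odd; case: (f' _).
exists w, h, p.+1, q.+1, C, (int_vec R x0 y0); split.
- split; split=> //; try by rewrite /= ?ep ?eq_.
    by have : p.+1 != w.-1; [apply/eqP => E; have : odd w.-1; [rewrite -E /= ep | lia] | lia].
  by have : q.+1 != h.-1; [apply/eqP => E; have : odd h.-1; [rewrite -E /= eq_ | lia] | lia].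
- exists (fun i => (e' i)%:R), (fun j => (f' j)%:R); split.
    split.
      apply: (@labels_of_cross_type h q e' (fun i => line_type b e (y0 + i%:Z))) => //.
      by rewrite addr0.
    apply: (@labels_of_cross_type w p f' (fun j => line_type b f (x0 + j%:Z))) => //.
    by rewrite addr0.
  split.
  + by rewrite -(labelled_label_pattern lab').
  + have [ext_ _ _ _ _] := loop_extent loopL ld.
    move=> r /translateE /ext_ [] /=; rewrite !intrN => a1 a2.
    by split; lra.
  + exact: has_width_translate.
  + exact: has_height_translate.
have -> : int_vec R x0 y0 = - int_vec R (- x0) (- y0).
  by rewrite /int_vec !intrN; congr pair; rewrite /= opprK.
by rewrite -[RHS]/(translate _ C) translateK.
Qed.

(** The two bounding boxes correspond, and both have integral corners. *)
Lemma translate_loops_integral (e f e' f' : int -> bool) P P' (C : set (R * R)) (v : R * R)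
    x0 y0 x0' y0' (w' h' : nat) :
  loop_of P L -> loop_data x0 y0 w h e f (hstitch_in L) (vstitch_in L) ->
  loop_of P' C -> loop_data x0' y0' w' h' e' f' (hstitch_in C) (vstitch_in C) ->
  L = translate v C ->
  [/\ w' = w, h' = h & v = int_vec R (x0 - x0') (y0 - y0')].
Proof.
move=> loopL ld loopC ldC LE.
have [eL [pl pL pl1] [pr prL pr1] [pb pbL pb1] [pt ptL pt1]] := loop_extent loopL ld.
have [eC [ql qL ql1] [qr qrL qr1] [qb qbL qb1] [qt qtL qt1]] := loop_extent loopC ldC.
have toC p : L p -> x0'%:~R <= p.1 - v.1 <= x0'%:~R + w'%:R /\ y0'%:~R <= p.2 - v.2 <= y0'%:~R + h'%:R.
  by rewrite LE => /translateE /eC.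
have toL q : C q -> x0%:~R <= q.1 + v.1 <= x0%:~R + w%:R /\ y0%:~R <= q.2 + v.2 <= y0%:~R + h%:R.
  by move=> Cq; apply: (eL (q + v)); rewrite LE; exists q.
have [a1 _] := toC _ pL; have [a2 _] := toC _ prL; have [_ a3] := toC _ pbL; have [_ a4] := toC _ ptL.
have [b1 _] := toL _ qL; have [b2 _] := toL _ qrL; have [_ b3] := toL _ qbL; have [_ b4] := toL _ qtL.
rewrite pl1 in a1; rewrite pr1 in a2; rewrite pb1 in a3; rewrite pt1 in a4.
rewrite ql1 in b1; rewrite qr1 in b2; rewrite qb1 in b3; rewrite qt1 in b4.
have [vx wE] := extent_unique a1 a2 b1 b2; have [vy hE] := extent_unique a3 a4 b3 b4.
split.
- by apply/eqP; rewrite -(eqr_nat R) wE.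
- by apply/eqP; rewrite -(eqr_nat R) hE.
by rewrite [v]surjective_pairing /int_vec !intrB vx vy.
Qed.

(** The left and bottom sides of the box fix the colour of the inner cells;
    then the labels give the types of the lines, to which [cell_count_cross]
    applies. *)
Lemma cross_is_extremal e f P : labelled e f P -> loop_of P L ->
  has_width L w%:R -> has_height L h%:R ->
  is_cross L -> area L = (2 * (w%:R + h%:R) - 7)%:E.
Proof.
move=> Plab loopL hw hh [w' [h' [al [be [C [v [[[ow oh w5 h5] [oa ob ab bb]]
  [eps [eta [[le_ lh] [loopC Cbox Cw Ch]]]] LE]]]]]]].
have [x0 [y0 ld]] := loop_data_of_loop Plab loopL hw hh.
have lab' := label_pattern_labelled eps eta.
have [x0' [y0' ldC]] := loop_data_of_loop lab' loopC Cw Ch.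
have [ww hhh vE] := translate_loops_integral loopL ld loopC ldC LE.
subst w' h'.
have [eC [ql qL ql1] [qr qrL qr1] [qb qbL qb1] [qt qtL qt1]] := loop_extent loopC ldC.
have [x00 y00] : x0' = 0 /\ y0' = 0.
  have [[l1 _] [_ r1]] := (Cbox _ qL, Cbox _ qbL); have [[l2 _] [_ r2]] := (Cbox _ qrL, Cbox _ qtL).
  rewrite ql1 in l1; rewrite qr1 in l2; rewrite qb1 in r1; rewrite qt1 in r2.
  case/andP: l1 => l1 _; case/andP: r1 => r1 _; case/andP: l2 => _ l2; case/andP: r2 => _ r2.
  split; apply/eqP; rewrite eq_le -!(ler_int R) mulr0z ?l1 ?r1 andbT.
    by rewrite -(lerD2r w%:R) add0r.
  by rewrite -(lerD2r h%:R) add0r.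
subst x0' y0'.
have [a [b [cfg bE u0 t0 [uw th]]]] := loop_data_config ldC w_ge3.
have winE : window x0 y0 (vstitch_in L) = window 0 0 (vstitch_in C).
  have VE x y : vstitch_in L x y = vstitch_in C (x - x0) (y - y0).
    apply: asbool_equiv_eq.
    have := stitches_in_shift x0 y0 C (VStitch (x - x0) (y - y0)).
    by rewrite /= !subrK LE vE !subr0.
  rewrite /window /inside; apply/funext => x; apply/funext => y.
  have -> : (absz (x0 + x%:Z - x0)%R) = (absz (0 + x%:Z - 0)%R) by lia.
  have -> : (x0 <= x0 + x%:Z) = (0 <= 0 + x%:Z) by lia.
  by congr andb; apply: eq_bigr => j _; rewrite VE; congr vstitch_in; lia.
rewrite (area_loop loopL ld) area_eq_nat winE.
have b0 : b = false.
  by move: u0; rewrite /line_type (lh 0%N) //=; case: (b).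
have a0 : a = false by move: bE; rewrite b0 /=; case: (a).
rewrite a0 in cfg.
rewrite b0 in cfg.
apply: (cell_count_cross cfg w_odd h_odd (p := al.-1) (q := be.-1)).
- by clear -oa ab; lia.
- by clear -ob bb; lia.
- by clear -ab; lia.
- by clear -bb; lia.
- by apply: (@cross_type_of_labels w al _ eta) => //; clear -ab; lia.
- by apply: (@cross_type_of_labels h be _ eps) => //; clear -bb; lia.
exact: window_no_isolated ldC w_ge3.
Qed.

End Analysis.

Theorem theorem2p5 (R : realType) (w h : nat) (L : set (R * R)) :
  odd w -> odd h -> (3 <= w)%N -> (3 <= h)%N ->
  hitomezashi_loop L -> has_width L w%:R -> has_height L h%:R ->
  ((2 * (w%:R + h%:R) - 7)%:E <= area L)%E /\
  (area L = (2 * (w%:R + h%:R) - 7)%:E <-> is_cross L \/ minn w h = 3%N).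
Proof.
move=> w_odd h_odd w3 h3 [P [/hitomezashi_labelled[e [f Plab]] loopL]] hw hh.
have [x0 [y0 ld]] := loop_data_of_loop Plab loopL hw hh.
have [a [b [cfg _ _ _ _]]] := loop_data_config ld w3.
split.
  rewrite (area_loop loopL ld) lee_fin.
  have := cell_count_ge cfg w3 h3; rewrite -(ler_nat R) natrM !natrD; lra.
split=> [ext|[cr|]].
- have [w5|w5] := leqP 5 w; last by right; lia.
  have [h5|h5] := leqP 5 h; last by right; lia.
  by left; apply: extremal_is_cross Plab loopL hw hh w5 h5 ext.
- exact: cross_is_extremal Plab loopL hw hh cr.
rewrite (area_loop loopL ld) area_eq_nat => min3.
have [w_eq|h_eq] : w = 3%N \/ h = 3%N by lia.
  by move: cfg h_odd; rewrite w_eq => cfg h_odd; apply: cell_count_thin cfg h3 h_odd.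
rewrite -cell_count_transpose addnC [(w + h)%N]addnC addnC.
have := config_transpose cfg; move: w_odd; rewrite h_eq => w_odd cfgT.
exact: cell_count_thin cfgT w3 w_odd.
Qed.
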